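(* There exist finite ranked posets $\Gamma$ for which the associated graded $\mathrm{gr}(\mathrm{Ext}_{A_\Gamma}(\mathbb{F},\mathbb{F}))$ is not isomorphic (as a bigraded vector space) to $\mathrm{Ext}_{A'_\Gamma}(\mathbb{F},\mathbb{F})$, and $\mathrm{gr}(\mathrm{Tor}^{A_\Gamma}(\mathbb{F},\mathbb{F}))$ is not isomorphic to $\mathrm{Tor}^{A'_\Gamma}(\mathbb{F},\mathbb{F})$.
   Context: Fix a field $\mathbb{F}$. A finite ranked poset is a finite poset $\Gamma$ with a unique minimal element $*$ such that for every $x$ all maximal chains in $[*,x]$ have the same length $rk(x)$. $x$ covers $y$ ($x\to y$) if $y<x$ and $rk(x)-rk(y)=1$; these are the edges. Let $W$ be the $\mathbb{F}$-vector space with basis the edges, $T(W)$ the free algebra on $W$. For $a<b$, $\Pi(b,a)$ is the set of paths $b=c_0\to\cdots\to c_n=a$; for such a path $\pi$ with edges $e_1,\dots,e_n$ define $e(\pi,j)$ by $(s-e_1)\cdots(s-e_n)=\sum_j e(\pi,j)s^{n-j}$, $s$ a central indeterminate. The splitting algebra is $A_\Gamma=T(W)/I$, $I$ generated by all $e(\pi,j)-e(\pi',j)$ with $\pi,\pi'\in\Pi(b,a)$, $a<b$, $0\le j\le n$; it is graded with edges in degree 1. An edge $x\to y$ has rank $rk(x)$; $F^nA_\Gamma$ is the span of images of products of edges whose ranks sum to at most $n$; $A'_\Gamma$ is the associated graded algebra (keeping the grading by degree). This filtration induces filtrations on $\mathrm{Ext}_{A_\Gamma}(\mathbb{F},\mathbb{F})$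 and $\mathrm{Tor}^{A_\Gamma}(\mathbb{F},\mathbb{F})$ (trivial module $\mathbb{F}$), whose associated graded objects are denoted $\mathrm{gr}(\cdot)$; Ext and Tor are bigraded by homological and internal degree. *)

(* Defs.v *)
From HB Require Import structures.
From mathcomp Require Import all_boot all_order all_algebra.

Set Implicit Arguments.
Unset Strict Implicit.
Unset Printing Implicit Defensive.

Import GRing.Theory.
Local Open Scope ring_scope.

Section Poset.
Variables (T : finType) (le : rel T).

Definition ltp (x y : T) : bool := (x != y) && le x y.

Definition is_poset : Prop := [/\ reflexive le, antisymmetric le & transitive le].

Definition minimal (m : T) : Prop := forall y, le y m -> y = m.

Definition sat_chain (star x : T) (s : seq T) : Prop :=
  [/\ path ltp star s, last star s = x &
      forall k, (k < size s)%N -> forall z : T,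
        ~~ (ltp (nth star (star :: s) k) z && ltp z (nth star s k))].

Definition ranked_poset (star : T) (rk : T -> nat) : Prop :=
  [/\ is_poset, minimal star, (forall m, minimal m -> m = star) &
      forall x s, sat_chain star x s -> size s = rk x].

End Poset.

Section Splitting.
Variables (F : fieldType) (T : finType) (le : rel T) (rk : T -> nat).

Definition covers (p : T * T) : bool := ltp le p.2 p.1 && (rk p.1 == (rk p.2).+1)%N.
Definition edge : finType := {p : T * T | covers p}.
Definition src (e : edge) : T := (val e).1.
Definition tgt (e : edge) : T := (val e).2.

Definition weight (w : seq edge) : nat := (\sum_(e <- w) rk (src e))%N.

Definition words (n : nat) : seq (seq edge) := [seq tval t | t : n.-tuple edge].
Definition wordsle (n : nat) : seq (seq edge) := flatten [seq words l | l <- iota 0 n.+1].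

Definition is_pathb (b a : T) (p : seq edge) : bool :=
  if p is e :: p' then
    [&& src e == b, tgt (last e p') == a & path (fun e1 e2 => tgt e1 == src e2) e p']
  else false.

(* e(pi, k), as a coefficient function on words: (s - e_1)...(s - e_n) =
   sum_k e(pi,k) s^(n-k), so e(pi,k) = (-1)^k sum_{i_1<..<i_k} e_{i_1}...e_{i_k} *)
Definition esym (p : seq edge) (k : nat) (w : seq edge) : F :=
  (-1) ^+ k * (\sum_(m : (size p).-tuple bool | (count id m == k) && (mask m p == w)) 1).

Definition allpaths : seq (seq edge) := flatten [seq words n | n <- iota 0 #|T|].

Definition same_ends (pp : seq edge * seq edge) : bool :=
  [exists b : T, exists a : T, is_pathb b a pp.1 && is_pathb b a pp.2].

Definition gens : seq (seq edge -> F) :=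
  [seq (fun w => esym x.1.1 x.2 w - esym x.1.2 x.2 w)
  | x <- flatten [seq [seq (pp, k) | k <- iota 0 (size pp.1).+1]
                 | pp <- [seq pp <- allpairs pair allpaths allpaths | same_ends pp]]].

(* coefficient at word w of the product u * r * v (u, v words) *)
Definition ins_val (u : seq edge) (r : seq edge -> F) (v : seq edge) (w : seq edge) : F :=
  if [&& (size u + size v <= size w)%N, take (size u) w == u
       & drop (size w - size v) w == v]
  then r (take (size w - size u - size v) (drop (size u) w)) else 0.

(* degree-j component of the free algebra T(W) *)
Definition Tsp (j : nat) := {ffun j.-tuple edge -> F^o}.

Definition tvec (j : nat) (u : seq edge) (r : seq edge -> F) (v : seq edge) : Tsp j :=
  [ffun w => ins_val u r v (tval w)].

Definition Ideal (j : nat) : {vspace Tsp j} :=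
  <<[seq tvec j uv.1 r uv.2 | uv <- allpairs pair (wordsle j) (wordsle j), r <- gens]>>%VS.

Definition tdelta (j : nat) (w : j.-tuple edge) : Tsp j := [ffun w' => (w' == w)%:R].

Definition Fw (j n : nat) : {vspace Tsp j} :=
  <<[seq tdelta w | w <- enum [pred w : j.-tuple edge | (weight w <= n)%N]]>>%VS.

Definition projw (j n : nat) : 'End(Tsp j) :=
  linfun (fun x : Tsp j => [ffun w : j.-tuple edge => if weight w == n then x w else 0] : Tsp j).

(* leading-form (associated graded) subspace: gr U = sum_n top_n (U cap F^n) *)
Definition lead (j : nat) (U : {vspace Tsp j}) : {vspace Tsp j} :=
  (\sum_(n < (j * #|T|).+1) (projw j n @: (U :&: Fw j n)))%VS.

(* A'_Gamma = gr A_Gamma = T(W) / gr(I) *)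
Definition Ideal' (j : nat) : {vspace Tsp j} := lead (Ideal j).

(* In internal degree j >= 1, the bar complex is
   C_i = (+)_{c composition of j in i positive parts} B_{c_1} (x) ... (x) B_{c_i};
   a composition is encoded by its set S of cut positions in {1..j-1}
   (|S| = i - 1) and B_{c_1} (x) ... (x) B_{c_i} = T_j / K_S.
   We work in the ambient space Vsp j with basis (S, w), lifting everything. *)
Definition Vsp (j : nat) := {ffun {set 'I_j} * j.-tuple edge -> F^o}.

Definition validS (j : nat) (S : {set 'I_j}) : bool := [forall s in S, (0 < val s)%N].

Definition bdelta (j : nat) (x : {set 'I_j} * j.-tuple edge) : Vsp j :=
  [ffun y => (y == x)%:R].

Definition Pc (j i : nat) : {vspace Vsp j} :=
  <<[seq bdelta x | x <- enum [pred x : {set 'I_j} * j.-tuple edge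
                              | validS x.1 && (#|x.1|.+1 == i)%N]]>>%VS.

(* bar differential: removing the cut s merges two adjacent tensor factors *)
Definition Dbar (j : nat) : 'End(Vsp j) :=
  linfun (fun x : Vsp j => [ffun y : {set 'I_j} * j.-tuple edge =>
    \sum_(s : 'I_j | (s \notin y.1) && (0 < val s)%N)
       (-1) ^+ #|[set t in y.1 | (val t < val s)%N]| * x (s |: y.1, y.2)] : Vsp j).

(* transpose of Dbar (on valid cut sets): the cobar differential *)
Definition Dcobar (j : nat) : 'End(Vsp j) :=
  linfun (fun phi : Vsp j => [ffun y : {set 'I_j} * j.-tuple edge =>
    if validS y.1 then
      \sum_(s in y.1) (-1) ^+ #|[set t in y.1 | (val t < val s)%N]| * phi (y.1 :\ s, y.2)
    else 0] : Vsp j).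

Definition cutn (j : nat) (S : {set 'I_j}) (n : nat) : bool := [exists s in S, val s == n].

Definition isblock (j : nat) (S : {set 'I_j}) (pq : nat * nat) : bool :=
  [&& (pq.1 < pq.2 <= j)%N, (pq.1 == 0%N) || cutn S pq.1, (pq.2 == j) || cutn S pq.2
    & [forall s in S, ~~ (pq.1 < val s < pq.2)%N]].

Definition extT (k : nat) (g : Tsp k) (w : seq edge) : F :=
  \sum_(t : k.-tuple edge | tval t == w) g t.

Definition kvec (j : nat) (S : {set 'I_j}) (k : nat) (u : seq edge) (g : Tsp k)
  (v : seq edge) : Vsp j :=
  [ffun x => if x.1 == S then ins_val u (@extT k g) v (tval x.2) else 0].

Section Bar.
Variable J : forall k : nat, {vspace Tsp k}.

(* K = sum_S K_S, K_S = sum over blocks [p,q) of S of T_p (x) J_{q-p} (x) T_{j-q} *)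
Definition Kc (j : nat) : {vspace Vsp j} :=
  <<flatten [seq flatten [seq flatten
       [seq [seq kvec Sc uv.1 g uv.2 | g <- vbasis (J (pq.2 - pq.1))]
       | uv <- allpairs pair (words pq.1) (words (j - pq.2))]
     | pq <- [seq pq <- allpairs pair (iota 0 j.+1) (iota 0 j.+1) | isblock Sc pq]]
   | Sc <- enum [pred Sc : {set 'I_j} | validS Sc]]>>%VS.

Definition Zc (j i : nat) : {vspace Vsp j} := (Pc j i :&: (Dbar j @^-1: Kc j))%VS.
Definition Bc (j i : nat) : {vspace Vsp j} := (Dbar j @: Pc j i.+1 + (Kc j :&: Pc j i))%VS.

Definition tor_dim (i j : nat) : nat :=
  if j == 0%N then (i == 0%N : nat) else (\dim (Zc j i) - \dim (Bc j i))%N.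

Definition FV (j n : nat) : {vspace Vsp j} :=
  <<[seq bdelta x | x <- enum [pred x : {set 'I_j} * j.-tuple edge | (weight x.2 <= n)%N]]>>%VS.
Definition GV (j n : nat) : {vspace Vsp j} :=
  <<[seq bdelta x | x <- enum [pred x : {set 'I_j} * j.-tuple edge | (n <= weight x.2)%N]]>>%VS.

(* dim F^n Tor_{i,j}: classes of cycles having a representative of weight <= n *)
Definition torF_dim (j i n : nat) : nat :=
  (\dim ((Zc j i :&: (FV j n + Kc j)) + Bc j i) - \dim (Bc j i))%N.

Definition grtor_dim (i j : nat) : nat :=
  if j == 0%N then (i == 0%N : nat) else
  (\sum_(n < (j * #|T|).+1)
     (torF_dim j i n - (if val n is n'.+1 then torF_dim j i n' else 0%N)))%N.

(* cochains Hom(C_i, F) = functionals on P_i vanishing on K *)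
Definition perp (j : nat) (U : {vspace Vsp j}) : {vspace Vsp j} :=
  (\bigcap_(b <- vbasis U)
     lker (linfun (fun phi : Vsp j => ((\sum_x phi x * b x)%R : F^o)) : 'Hom(Vsp j, F^o)))%VS.

Definition Qc (j i : nat) : {vspace Vsp j} := (Pc j i :&: perp (Kc j))%VS.
Definition ZE (j i : nat) : {vspace Vsp j} := (Qc j i :&: lker (Dcobar j))%VS.
Definition BE (j i : nat) : {vspace Vsp j} := (Dcobar j @: Qc j i.-1)%VS.

Definition ext_dim (i j : nat) : nat :=
  if j == 0%N then (i == 0%N : nat) else (\dim (ZE j i) - \dim (BE j i))%N.

(* induced (decreasing) filtration: F^n Ext = classes of cocycles vanishing on
   F^(n-1) C, i.e. supported on weights >= n *)
Definition extF_dim (j i n : nat) : nat :=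
  (\dim ((ZE j i :&: GV j n) + BE j i) - \dim (BE j i))%N.

Definition grext_dim (i j : nat) : nat :=
  if j == 0%N then (i == 0%N : nat) else
  (\sum_(n < (j * #|T|).+1) (extF_dim j i n - extF_dim j i n.+1))%N.

End Bar.

End Splitting.

(* Main.v *)
Require Import Defs.
From HB Require Import structures.
From mathcomp Require Import all_boot all_order all_algebra.
From mathcomp Require Import zify ring.

(* For any family J of relation spaces, Tor and Ext in bidegree (2, 3) both have dimension
   dim J_3 - dim Q(J), where Q(J) = J_1 T_2 + T_1 J_2 + J_2 T_1 + T_2 J_1: they count the
   cubic relations that do not follow from those of degree at most 2. Passing to leading
   forms preserves dim I_3, and gr Q(I) contains Q(gr I); when this inclusion is strict,
   Ext and Tor of A' are strictly larger than those of A, hence than their associated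
   graded spaces.

   It is strict for the poset with elements u, v1, v2, y1, y2, z1, z2, * and covers
   u -> v1, v2; vi -> y1, y2; yi -> zi; zi -> *. Below v1 (and below v2) the chains through
   y1 and through y2 are disconnected, so A' needs one cubic relation for each of v1 and v2.
   But the 4-cycle v1, y1, v2, y2 below u is a syzygy between the leading forms of the
   quadratic relations, and its lower-order part is the difference of these two cubic
   relations. So in A one of the two is redundant. In A' it is not, as detected by the cubic
   form v1* (x) (y1* + y2* ) (x) z1*, which vanishes on Q(gr I). *)

Set Implicit Arguments.
Unset Strict Implicit.
Unset Printing Implicit Defensive.

Import GRing.Theory.
Local Open Scope ring_scope.

(** * Functions on a finite type *)

Lemma linfunE (F : fieldType) (aT rT : vectType F) (f : aT -> rT) :
  linear f -> linfun f =1 f.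
Proof.
move=> fL.
pose g : {linear aT -> rT} := HB.pack f (GRing.isLinear.Build F aT rT *:%R f fL).
exact: (lfunE g).
Qed.

Lemma span_ind (F : fieldType) (vT : vectType F) (X : seq vT) (U : {vspace vT}) :
  (forall x, x \in X -> x \in U) -> (<<X>> <= U)%VS.
Proof. by move=> XU; apply/span_subvP. Qed.

Section FinFun.
Variables (F : fieldType) (I : finType).
Local Notation V := {ffun I -> F^o}.

Definition delta (x : I) : V := [ffun y => (y == x)%:R].

Lemma ffun_sum_delta (v : V) : v = \sum_x v x *: delta x.
Proof.
apply/ffunP => y; rewrite sum_ffunE (bigD1 y) //= !ffunE eqxx.
rewrite big1 ?addr0 => [|x]; first by rewrite /GRing.scale /= mulr1.
by rewrite !ffunE eq_sym => /negPf ->; rewrite scaler0.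
Qed.

(** The spaces [Fw], [Pc], [FV] and [GV] are all spans of this shape, so membership in each becomes
    vanishing off a set of indices. *)
Lemma mem_span_delta (P : pred I) (v : V) :
  reflect (forall y, ~~ P y -> v y = 0)
          (v \in <<[seq delta x | x <- enum [pred x | P x]]>>%VS).
Proof.
apply: (iffP idP) => [|v0].
  move=> vP y Py.
  have lL : linear (fun v : V => (v y : F^o)) by move=> a b c; rewrite !ffunE.
  suff /subvP/(_ v vP) : (<<[seq delta x | x <- enum [pred x | P x]]>>
      <= lker (linfun (fun v : V => (v y : F^o))))%VS.
    by rewrite memv_ker linfunE // => /eqP.
  apply: span_ind => _ /mapP[x + ->]; rewrite mem_enum inE => Px.
  rewrite memv_ker linfunE // ffunE; case: (y =P x) => [yx|//].
  by move: Py; rewrite yx Px.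
rewrite (ffun_sum_delta v); apply: rpred_sum => x _.
case: (boolP (P x)) => [Px|/v0 ->]; last by rewrite scale0r rpred0.
by apply/rpredZ/memv_span/map_f; rewrite mem_enum.
Qed.

Definition pairing (phi : I -> F) (v : V) : F^o := \sum_x phi x * v x.

Lemma pairing_linear phi : linear (pairing phi).
Proof.
move=> a v w; rewrite /pairing /GRing.scale /= mulr_sumr -big_split.
apply: eq_bigr => x _; rewrite !ffunE /= mulrDr; congr (_ + _).
by rewrite /GRing.scale /= mulrCA.
Qed.

Lemma pairing_delta phi x : pairing phi (delta x) = phi x.
Proof.
rewrite /pairing (bigD1 x) //= ffunE eqxx mulr1 big1 ?addr0 // => y /negPf yx.
by rewrite ffunE yx mulr0.
Qed.

Definition pairingL phi : 'Hom(V, F^o) := linfun (pairing phi).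

Lemma pairingLE phi v : pairingL phi v = pairing phi v.
Proof. exact/linfunE/pairing_linear. Qed.

(* [perp] of the bar complex is the instance of this on [Vsp j]. *)
Definition annih (U : {vspace V}) : {vspace V} :=
  (\bigcap_(b <- vbasis U)
     lker (linfun (fun phi : V => ((\sum_x phi x * b x)%R : F^o))))%VS.

Lemma annihP (U : {vspace V}) (phi : V) :
  reflect (forall u, u \in U -> pairing phi u = 0) (phi \in annih U).
Proof.
have bL (b : V) : linear (fun phi : V => ((\sum_x phi x * b x)%R : F^o)).
  move=> a v w; rewrite /GRing.scale /= mulr_sumr -big_split.
  by apply: eq_bigr => x _; rewrite !ffunE /= mulrDl; congr (_ + _);
     rewrite /GRing.scale /= mulrA.
have -> : (phi \in annih U) = all (fun b => pairing phi b == 0) (vbasis U).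
  rewrite /annih; elim: (tval (vbasis U)) => [|b s IH] /=.
    by rewrite big_nil memvf.
  by rewrite big_cons memv_cap IH memv_ker linfunE.
apply: (iffP allP) => [H u uU|H b /vbasis_mem bU]; last by apply/eqP/H.
have /subvP/(_ u) : (U <= lker (pairingL phi))%VS.
  rewrite -{1}(span_basis (vbasisP U)); apply: span_ind => b /H.
  by rewrite memv_ker pairingLE.
by rewrite uU memv_ker pairingLE => /(_ isT)/eqP.
Qed.

(** Rank-nullity for the map [f] pairing a vector with a basis of [U]: its kernel is [annih U], and
    it is onto because the coordinate matrix [M] of the basis has independent rows. *)
Lemma dim_annih (U : {vspace V}) : (\dim (annih U) + \dim U)%N = \dim {:V}.
Proof.
set m := \dim U; pose b := vbasis U.
pose M : 'M[F]_(m, #|I|) := \matrix_(i, k) b`_i (enum_val k).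
have rvL : linear (fun phi : V => \row_k phi (enum_val k) : 'rV[F]_#|I|).
  by move=> a v w; apply/rowP => k; rewrite !mxE !ffunE.
pose f (phi : V) : 'rV[F]_m := (\row_k phi (enum_val k)) *m M^T.
have fL : linear f by move=> a v w; rewrite /f rvL mulmxDl -scalemxAl.
have fE phi i : f phi 0 i = pairing phi b`_i.
  rewrite mxE /pairing (reindex (fun k : 'I_#|I| => enum_val k)) /=;
    last exact/onW_bij/enum_val_bij.
  by apply: eq_bigr => k _; rewrite !mxE.
have Mfree : row_free M.
  apply: inj_row_free => c cM0.
  have /freeP/(_ (fun i => c 0 i)) fr := basis_free (vbasisP U).
  apply/rowP => i; rewrite fr ?mxE //.
  apply/ffunP => x; rewrite sum_ffunE ffunE.
  have /rowP/(_ (enum_rank x)) := cM0; rewrite !mxE => {2}<-.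
  by apply: eq_bigr => k _; rewrite !mxE enum_rankK !ffunE.
have /row_fullP[N NM] : row_full M^T by rewrite /row_full mxrank_tr.
rewrite -(limg_ker_dim (linfun f) fullv) capfv; congr (\dim _ + _)%N.
  apply/vspaceP => phi; rewrite memv_ker linfunE //.
  apply/annihP/eqP => [H|H u uU].
    by apply/rowP => i; rewrite fE mxE H ?vbasis_mem ?mem_nth ?size_tuple.
  rewrite (coord_vbasis uU) -pairingLE linear_sum big1 // => i _.
  by rewrite linearZ /= pairingLE -fE H mxE scaler0.
have -> : limg (linfun f) = fullv; last first.
  by rewrite dimvf /dim /= mul1n.
apply/eqP; rewrite eqEsubv subvf /=; apply/subvP => y _.
(* [N] is a left inverse of [M^T], so [y *m N], read as a function, is a preimage of [y]. *)
apply/memv_imgP; exists [ffun x => (y *m N) 0 (enum_rank x)]; first exact: memvf.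
rewrite linfunE // /f.
have -> : \row_k [ffun x => (y *m N) 0 (enum_rank x)] (enum_val k) = y *m N.
  by apply/rowP => k; rewrite !mxE ffunE enum_valK mxE.
by rewrite -mulmxA NM mulmx1.
Qed.

End FinFun.

(** * Leading forms *)

Section Leading.
Variables (F : fieldType) (T : finType) (le : rel T) (rk : T -> nat).
Local Notation E := (edge le rk).
Local Notation Ts := (Tsp F le rk).
Local Notation wt := (@weight T le rk).

Lemma weight_cat u v : wt (u ++ v) = (wt u + wt v)%N.
Proof. exact: big_cat. Qed.

Lemma weight_nil : wt [::] = 0%N.
Proof. exact: big_nil. Qed.

Lemma weight_cons e u : wt (e :: u) = (rk (src e) + wt u)%N.
Proof. exact: big_cons. Qed.

Lemma FwP j n (x : Ts j) :
  reflect (forall w : j.-tuple E, (n < wt w)%N -> x w = 0) (x \in Fw F le rk j n).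
Proof.
apply: (iffP (mem_span_delta (fun w : j.-tuple E => (wt w <= n)%N) x)) => H w.
  by rewrite ltnNge; apply: H.
by rewrite -ltnNge; apply: H.
Qed.

Lemma projwE j n (x : Ts j) (w : j.-tuple E) :
  projw F le rk j n x w = if wt w == n then x w else 0.
Proof.
rewrite /projw linfunE ?ffunE // => a v u; apply/ffunP => t; rewrite !ffunE.
by case: ifP; rewrite ?ffunE // scaler0 addr0.
Qed.

Section Bounded.
Hypothesis rk_le : forall x, (rk x <= #|T|)%N.

Lemma weight_le u : (wt u <= size u * #|T|)%N.
Proof.
elim: u => [|e u IH]; first by rewrite weight_nil.
by rewrite weight_cons mulSn leq_add.
Qed.

(** The sum defining [lead] stops at [j * #|T|]; nothing is lost, since no word of length [j] is
    heavier and the projections vanish beyond. *)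
Lemma mem_lead j n (U : {vspace Ts j}) x :
  x \in U -> x \in Fw F le rk j n -> projw F le rk j n x \in lead U.
Proof.
move=> xU xF; have [ltn|len] := ltnP n (j * #|T|).+1.
  have /subvP : (projw F le rk j n @: (U :&: Fw F le rk j n) <= lead U)%VS.
    exact: (sumv_sup (Ordinal ltn)).
  by apply; rewrite memv_img // memv_cap xU.
suff -> : projw F le rk j n x = 0 by exact: rpred0.
apply/ffunP => w; rewrite projwE ffunE; case: eqP => // wn.
by have := weight_le w; rewrite size_tuple wn leqNgt len.
Qed.

(** The kernel of the weight-n projection on the part of [U] of filtration n is the part of
    filtration n - 1, so by rank-nullity the graded pieces have total dimension that of [U]. *)
Lemma dim_lead j (U : {vspace Ts j}) : \dim (lead U) = \dim U.
Proof.
(* [Flt n] allows only weights strictly below n; with this shift [Flt 0] is zero and the induction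
   can start there. *)
pose Flt n := if n is n'.+1 then Fw F le rk j n' else 0%VS.
have FltP n (x : Ts j) : reflect (forall w : j.-tuple E, (n <= wt w)%N -> x w = 0) (x \in Flt n).
  case: n => [|n] /=; last exact: FwP.
  rewrite memv0; apply: (iffP eqP) => [-> w _|H]; first by rewrite ffunE.
  by apply/ffunP => w; rewrite H ?ffunE.
pose L n := (projw F le rk j n @: (U :&: Fw F le rk j n))%VS.
have dL n : (\dim (U :&: Flt n) + \dim (L n))%N = \dim (U :&: Flt n.+1).
  rewrite -(limg_ker_dim (projw F le rk j n) (U :&: Fw F le rk j n)).
  congr (\dim _ + _)%N; apply/vspaceP => x.
  rewrite !memv_cap -andbA; congr (_ && _); rewrite memv_ker.
  apply/idP/idP => [/FltP xF|/andP[/FwP xF /eqP x0]].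
    apply/andP; split; first by apply/FwP => w /ltnW/xF.
    apply/eqP/ffunP => w; rewrite projwE ffunE; case: eqP => // wn.
    by rewrite xF ?wn.
  apply/FltP => w; rewrite leq_eqVlt => /orP[/eqP wn|/xF //].
  by have /ffunP/(_ w) := x0; rewrite projwE -wn eqxx ffunE.
have Lsum m : \dim (\sum_(n < m) L n) = \dim (U :&: Flt m).
  elim: m => [|m IH]; first by rewrite big_ord0 /= capv0.
  (* The sum is direct: the earlier pieces live in weights below [m], the new one in weight [m]
     only. *)
  rewrite big_ord_recr /= -[RHS](dL m) -IH dimv_disjoint_sum //.
  apply/eqP; rewrite -subv0; apply/subvP => x; rewrite memv_cap memv0.
  case/andP=> xm /memv_imgP[y _ xy].
  have /subvP/(_ x xm)/FltP x0 : (\sum_(n < m) L n <= Flt m)%VS.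
    apply/subv_sumP => i _; apply/subvP => _ /memv_imgP[z _ ->].
    apply/FltP => w wm; rewrite projwE; case: eqP => // wi.
    by move: wm; rewrite wi leqNgt ltn_ord.
  apply/eqP/ffunP => w; rewrite ffunE xy projwE; case: eqP => // wn.
  by have := x0 w; rewrite wn leqnn xy projwE wn eqxx => ->.
rewrite /lead Lsum; congr (\dim _); apply/capv_idPl/subvP => x _.
by apply/FltP => w; rewrite ltnNge -{2}(size_tuple w) weight_le.
Qed.

End Bounded.

Lemma lead_ind j (U V : {vspace Ts j}) :
  (forall n x, x \in U -> x \in Fw F le rk j n -> projw F le rk j n x \in V) ->
  (lead U <= V)%VS.
Proof.
move=> H; apply/subv_sumP => n _; apply/subvP => _ /memv_imgP[x + ->].
by rewrite memv_cap => /andP[xU xF]; apply: H.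
Qed.

(* If [psi] agrees with [phi] in weight [n] and has only terms of higher weight besides,
   then on an element of filtration [m] the functional [phi] sees the weight-[n] part,
   where it cannot be distinguished from [psi]. *)
Lemma annihilates_lead j (n : nat) (phi psi : j.-tuple E -> F) (U : {vspace Ts j}) :
  (forall w : j.-tuple E, phi w = if wt w == n then psi w else 0) ->
  (forall w : j.-tuple E, (wt w < n)%N -> psi w = 0) ->
  (U <= lker (pairingL psi))%VS -> (lead U <= lker (pairingL phi))%VS.
Proof.
move=> phiE psi0 /subvP Upsi; apply: lead_ind => m x /Upsi xpsi /FwP xF.
rewrite memv_ker pairingLE; apply/eqP; have [mn|mn] := eqVneq m n.
  move: xpsi; rewrite memv_ker pairingLE => /eqP <-.
  apply: eq_bigr => w _.
  rewrite projwE phiE mn; case: ltngtP => [/psi0 ->|nw|] //; rewrite ?mul0r //.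
  by rewrite xF ?mulr0 // mn.
rewrite [LHS]big1 // => w _; rewrite projwE phiE.
case: (eqVneq (wt w) m) => [->|_]; rewrite ?mulr0 //.
by rewrite (negPf mn) mul0r.
Qed.

End Leading.

(** * Words and the ideal of relations *)

Section Words.
Variables (F : fieldType) (T : finType) (le : rel T) (rk : T -> nat).
Local Notation E := (edge le rk).
Local Notation Ts := (Tsp F le rk).
Local Notation wt := (@weight T le rk).
Implicit Types (u v w t : seq E) (r : seq E -> F).

Lemma ins_val_cat u r v t : ins_val u r v (u ++ t ++ v) = r t.
Proof.
rewrite /ins_val !size_cat.
have -> : (size u + (size t + size v) - size v = size (u ++ t))%N by rewrite size_cat; lia.
have -> : (size u + (size t + size v) - size u - size v = size t)%N by lia.
rewrite take_size_cat // {1}catA !drop_size_cat // !eqxx take_size_cat // !andbT.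
by have -> : (size u + size v <= size u + (size t + size v))%N by lia.
Qed.

(** Whether [w] has the shape u t v is independent of [r], so one case split serves all coefficient
    functions at once. *)
Lemma ins_valP u v w :
  (exists t, w = u ++ t ++ v) \/
  ((forall t, w <> u ++ t ++ v) /\ forall r, ins_val u r v w = 0).
Proof.
case c: [&& (size u + size v <= size w)%N, take (size u) w == u
         & drop (size w - size v) w == v]; [left | right; split=> [t wE|r]].
- case/and3P: c => uvw /eqP wu /eqP wv.
  exists (take (size w - size u - size v) (drop (size u) w)).
  rewrite -{1}(cat_take_drop (size u) w) wu; congr (_ ++ _).
  rewrite -{1}(cat_take_drop (size w - size u - size v) (drop (size u) w)).
  congr (_ ++ _); rewrite drop_drop -[RHS]wv; congr drop.
  by lia.
- have := ins_val_cat u (fun=> 1) v t; rewrite -wE /ins_val c => /eqP.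
  by rewrite eq_sym oner_eq0.
- by rewrite /ins_val c.
Qed.

(** Associativity of multiplication by words. If [w] is u t v, cancelling [u] and [v] turns a
    factorisation of [w] through the longer words into one of [t]. *)
Lemma ins_val_comp u u' r v' v w :
  ins_val u (ins_val u' r v') v w = ins_val (u ++ u') r (v' ++ v) w.
Proof.
have [[t wE]|[nw ->]] := ins_valP u v w; last first.
  have [[t wE]|[_ -> //]] := ins_valP (u ++ u') (v' ++ v) w.
  by case: (nw (u' ++ t ++ v')); rewrite wE -!catA.
rewrite wE ins_val_cat; have [[s tE]|[ns ->]] := ins_valP u' v' t.
  rewrite tE ins_val_cat.
  have -> : u ++ (u' ++ s ++ v') ++ v = (u ++ u') ++ s ++ v' ++ v by rewrite -!catA.
  by rewrite ins_val_cat.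
have [[s tE]|[_ -> //]] := ins_valP (u ++ u') (v' ++ v) (u ++ t ++ v).
have /(congr1 (drop (size u))) : u ++ t ++ v = u ++ (u' ++ s ++ v') ++ v.
  by rewrite tE -!catA.
rewrite !drop_size_cat // => tvE; case: (ns s).
have tsz : size t = size (u' ++ s ++ v').
  by have /eqP := congr1 size tvE; rewrite !size_cat eqn_add2r => /eqP.
by have := congr1 (take (size t)) tvE; rewrite take_size_cat // tsz take_size_cat.
Qed.

Lemma mem_words n w : (w \in words le rk n) = (size w == n).
Proof.
apply/mapP/idP => [[t _ ->]|wn]; first by rewrite size_tuple.
by exists (Tuple wn); rewrite ?mem_enum.
Qed.

Lemma extT_tval k (g : Ts k) (t : k.-tuple E) : extT g (tval t) = g t.
Proof. by rewrite /extT big_pred1_eq. Qed.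

Lemma extT_ffun k r w : extT ([ffun t : k.-tuple E => r (tval t)] : Ts k) w =
  if size w == k then r w else 0.
Proof.
case: eqP => [wk|wk].
  by have -> : w = tval (Tuple (introT eqP wk)) by []; rewrite extT_tval ffunE.
by rewrite /extT big1 // => t /eqP tw; case: wk; rewrite -tw size_tuple.
Qed.

Lemma big_words n (G : seq E -> F) :
  \sum_(w <- words le rk n) G w = \sum_(t : n.-tuple E) G t.
Proof. by rewrite big_map enumT. Qed.

(** The transpose of multiplication by [u] and [v]: only words u t v contribute, and each comes from
    a single t. *)
Lemma sum_ins_val (phi r : seq E -> F) u v k j : j = (size u + k + size v)%N ->
  \sum_(w : j.-tuple E) phi w * ins_val u r v w =
  \sum_(t : k.-tuple E) phi (u ++ t ++ v) * r t.
Proof.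
move=> jE; rewrite -(big_words j (fun w => phi w * ins_val u r v w)).
rewrite -(big_words k (fun t => phi (u ++ t ++ v) * r t)).
pose s := [seq u ++ t ++ v | t <- words le rk k].
have uw n : uniq (words le rk n) by rewrite map_inj_uniq ?enum_uniq //; exact: val_inj.
have s0 w : w \in words le rk j -> w \notin s -> ins_val u r v w = 0.
  rewrite mem_words => /eqP wj /mapP ws; have [[t wE]|[_ -> //]] := ins_valP u v w.
  case: ws; exists t => //; rewrite mem_words; apply/eqP.
  by move: wj; rewrite wE jE !size_cat; lia.
rewrite (bigID (mem s)) /= [X in _ + X]big_seq_cond [X in _ + X]big1 ?addr0; last first.
  by move=> w /andP[wj ws]; rewrite s0 // mulr0.
rewrite -big_filter (perm_big s);
  first by rewrite big_map; apply: eq_bigr => t _; rewrite ins_val_cat.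
apply: uniq_perm => [||w]; first by rewrite filter_uniq.
  rewrite map_inj_uniq // => t t' tt'; have tst : size t = size t'.
    by move/(congr1 size): tt'; rewrite !size_cat; lia.
  have := congr1 (fun w => take (size t) (drop (size u) w)) tt'.
  by rewrite /= !drop_size_cat // take_size_cat // tst take_size_cat.
rewrite mem_filter mem_words; apply: andb_idr => /mapP[t].
by rewrite mem_words => /eqP tk ->; rewrite !size_cat tk jE addnA.
Qed.

End Words.

(** * Multiplication by words, and the relations as a two-sided ideal *)

Section Tmul.
Variables (F : fieldType) (T : finType) (le : rel T) (rk : T -> nat).
Local Notation E := (edge le rk).
Local Notation Ts := (Tsp F le rk).
Local Notation wt := (@weight T le rk).
Local Notation Id := (Ideal F le rk).
Implicit Types (u v w t : seq E) (r : seq E -> F).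

(** The product u g v read in degree [j]; it is zero unless [j] is the sum of the three degrees. *)
Definition tmul j k u (g : Ts k) v : Ts j :=
  [ffun w : j.-tuple E => ins_val u (extT g) v (tval w)].

Lemma extT_linear k w a (g h : Ts k) : extT (a *: g + h) w = a * extT g w + extT h w.
Proof.
by rewrite /extT mulr_sumr -big_split; apply: eq_bigr => t _; rewrite !ffunE.
Qed.

Lemma tmul_linear j k u v : linear (fun g : Ts k => tmul j u g v).
Proof.
move=> a g h; apply/ffunP => w; rewrite !ffunE /GRing.scale /=.
have [[t ->]|[_ w0]] := ins_valP F u v w; last by rewrite !w0 mulr0 addr0.
by rewrite !ins_val_cat extT_linear.
Qed.

(** The premise is a preimage inclusion so that it can be checked on generators of [U]. *)
Lemma tmul_sub j k u v (U : {vspace Ts k}) (V : {vspace Ts j}) :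
  (U <= linfun (fun g : Ts k => tmul j u g v) @^-1: V)%VS ->
  forall g, g \in U -> tmul j u g v \in V.
Proof.
move=> /subvP UV g /UV; rewrite -memv_preim linfunE //; exact: tmul_linear.
Qed.

Lemma pairing_tmul (phi : seq E -> F) j k u (g : Ts k) v :
  j = (size u + k + size v)%N ->
  pairing (fun w : j.-tuple E => phi w) (tmul j u g v) =
  pairing (fun t : k.-tuple E => phi (u ++ t ++ v)) g.
Proof.
move=> jE; rewrite /pairing; under eq_bigr do rewrite ffunE.
by rewrite (sum_ins_val _ _ jE); apply: eq_bigr => t _; rewrite extT_tval.
Qed.

Lemma pairing_tvec (phi : seq E -> F) j k u r v :
  j = (size u + k + size v)%N ->
  pairing (fun w : j.-tuple E => phi w) (tvec j u r v) =
  \sum_(t : k.-tuple E) phi (u ++ t ++ v) * r t.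
Proof.
move=> jE; rewrite /pairing; under eq_bigr do rewrite ffunE.
exact: sum_ins_val.
Qed.

Lemma tvec_oversize j u r v : (j < size u + size v)%N -> tvec j u r v = 0.
Proof. by move=> ltj; apply/ffunP => w; rewrite !ffunE /ins_val size_tuple leqNgt ltj. Qed.

Lemma extT_projw k n (x : Ts k) w :
  extT (projw F le rk k n x) w = if wt w == n then extT x w else 0.
Proof.
rewrite /extT; case: ifP => wn.
  by apply: eq_bigr => t /eqP tw; rewrite projwE tw wn.
by rewrite big1 // => t /eqP tw; rewrite projwE tw wn.
Qed.

(** Multiplying by words shifts every weight by the same constant, hence sends leading forms to
    leading forms. *)
Lemma tmul_projw j k u (x : Ts k) v n :
  tmul j u (projw F le rk k n x) v =
  projw F le rk j (wt u + n + wt v) (tmul j u x v).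
Proof.
apply/ffunP => w; rewrite projwE !ffunE.
have [[t ->]|[_ w0]] := ins_valP F u v w; last by rewrite !w0 if_same.
by rewrite !ins_val_cat extT_projw !weight_cat addnA !eqn_add2r eqn_add2l.
Qed.

Lemma tmul_Fw j k u (x : Ts k) v n :
  x \in Fw F le rk k n -> tmul j u x v \in Fw F le rk j (wt u + n + wt v).
Proof.
move=> /FwP xF; apply/FwP => w; rewrite ffunE.
have [[t ->]|[_ w0]] := ins_valP F u v w; last by rewrite !w0.
rewrite ins_val_cat !weight_cat addnA !ltn_add2r ltn_add2l => nt.
by rewrite /extT big1 // => s /eqP sE; rewrite xF // sE.
Qed.

Lemma tmul_lead j k u v (U : {vspace Ts k}) (W : {vspace Ts j}) :
  (forall x, (rk x <= #|T|)%N) ->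
  (forall g, g \in U -> tmul j u g v \in W) ->
  forall g, g \in lead U -> tmul j u g v \in lead W.
Proof.
move=> rk_le UW; apply/tmul_sub/lead_ind => n x xU xF.
rewrite -memv_preim linfunE; last exact: tmul_linear.
by rewrite tmul_projw mem_lead ?UW ?tmul_Fw.
Qed.

Lemma mem_wordsle n w : (w \in wordsle le rk n) = (size w <= n)%N.
Proof.
apply/flatten_mapP/idP => [[l]|wn].
  by rewrite mem_iota mem_words add0n ltnS => /andP[_ ln] /eqP ->.
by exists (size w); rewrite ?mem_words // mem_iota add0n ltnS.
Qed.

Lemma mem_allpaths w : (w \in allpaths le rk) = (size w < #|T|)%N.
Proof.
apply/flatten_mapP/idP => [[l]|wn].
  by rewrite mem_iota mem_words add0n => /andP[_ ln] /eqP ->.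
by exists (size w); rewrite ?mem_words // mem_iota add0n.
Qed.

Definition esymB (p p' : seq E) k w : F := Defs.esym F p k w - Defs.esym F p' k w.

(** The members of [gens] are functions, without decidable equality; indexing them by two paths and
    a degree makes membership expressible. *)
Let IdE j : Id j = <<[seq tvec j uv.1 (esymB x.1.1 x.1.2 x.2) uv.2
  | uv <- allpairs pair (wordsle le rk j) (wordsle le rk j),
    x <- [seq (pp, k) | pp <- [seq pp <- allpairs pair (allpaths le rk) (allpaths le rk)
                              | same_ends pp], k <- iota 0 (size pp.1).+1]]>>%VS.
Proof. by rewrite /Ideal /gens allpairs_mapr. Qed.

Lemma Ideal_gen j u v b a p p' k :
  is_pathb b a p -> is_pathb b a p' -> (size p < #|T|)%N -> (size p' < #|T|)%N ->
  (size u <= j)%N -> (size v <= j)%N -> (k <= size p)%N ->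
  tvec j u (esymB p p' k) v \in Id j.
Proof.
move=> pP pP' sp sp' su sv kp; rewrite IdE; apply: memv_span.
apply/allpairsP; exists ((u, v), ((p, p'), k)); split=> //.
  by apply/allpairsP; exists (u, v); rewrite !mem_wordsle.
apply/flatten_mapP; exists (p, p'); last by apply/mapP; exists k; rewrite ?mem_iota.
rewrite mem_filter; apply/andP; split.
  by apply/existsP; exists b; apply/existsP; exists a; rewrite /= pP.
by apply/allpairsP; exists (p, p'); rewrite !mem_allpaths.
Qed.

Lemma Ideal_ind j (V : {vspace Ts j}) :
  (forall u v b a p p' k,
     is_pathb b a p -> is_pathb b a p' -> (size p < #|T|)%N -> (size p' < #|T|)%N ->
     (size u <= j)%N -> (size v <= j)%N -> (k <= size p)%N ->
     tvec j u (esymB p p' k) v \in V) ->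
  (Id j <= V)%VS.
Proof.
move=> H; rewrite IdE; apply: span_ind => _ /allpairsP[[uv x] [uvP xP ->]].
case/allpairsP: uvP => [[u v] [+ + ->]].
case/flatten_mapP: xP => [[p p'] + /mapP[k + ->]].
rewrite mem_filter mem_iota !mem_wordsle => /andP[/existsP[b /existsP[a pp']]].
case/andP: pp' => pP pP' /allpairsP[[q q'] [qP qP' [pq pq']]].
by move: qP qP'; rewrite -pq -pq' !mem_allpaths => ? ? /andP[_ ?] ? ?; apply: (H _ _ b a).
Qed.

Lemma tmul_tvec j k u u' r v' v : j = (size u + k + size v)%N ->
  tmul j u (tvec k u' r v') v = tvec j (u ++ u') r (v' ++ v).
Proof.
move=> jE; apply/ffunP => w; rewrite !ffunE -ins_val_comp.
have := size_tuple w.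
have [[t ->]|[_ w0]] := ins_valP F u v w; last by rewrite !w0.
rewrite !ins_val_cat !size_cat jE => tk.
by rewrite extT_ffun; case: eqP => // /eqP /negP; case; apply/eqP; lia.
Qed.

Lemma tmul_Ideal j k u v : j = (size u + k + size v)%N ->
  forall g, g \in Id k -> tmul j u g v \in Id j.
Proof.
move=> jE; apply/tmul_sub/Ideal_ind => u' v' b a p p' m pP pP' sp sp' su sv mp.
rewrite -memv_preim linfunE; last exact: tmul_linear.
by rewrite tmul_tvec // (Ideal_gen pP pP') // size_cat; lia.
Qed.

End Tmul.

(** * Functionals vanishing on the relations *)

Lemma sum_tuple0 (F : fieldType) (A : finType) (G : seq A -> F) :
  \sum_(t : 0.-tuple A) G t = G [::].
Proof.
rewrite (bigD1 [tuple]) //= big1 ?addr0 // => t /eqP[].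
exact: tuple0.
Qed.

Lemma sum_tupleS (F : fieldType) (A : finType) (G : seq A -> F) n :
  \sum_(t : n.+1.-tuple A) G t = \sum_(a : A) \sum_(t : n.-tuple A) G (a :: t).
Proof.
rewrite pair_bigA /= (reindex (fun x : A * n.-tuple A => [tuple of x.1 :: x.2])) //=.
exists (fun t => (thead t, [tuple of behead t])) => [[a t] _|t _] /=.
  by congr (_, _); apply: val_inj.
by rewrite -tuple_eta.
Qed.

Section PathSums.
Variables (F : fieldType) (T : finType) (le : rel T) (rk : T -> nat).
Local Notation E := (edge le rk).
Local Notation Ts := (Tsp F le rk).
Local Notation Id := (Ideal F le rk).
Implicit Types (u v w t p : seq E) (A B C : T -> F) (alpha beta : E -> F).

Lemma esym_size p k w : size w != k -> Defs.esym F p k w = 0.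
Proof.
move=> wk; rewrite /Defs.esym big_pred0 ?mulr0 // => m.
apply/andP => -[/eqP mk /eqP mw]; move: wk.
by rewrite -mw size_mask ?size_tuple // mk eqxx.
Qed.

(** Coefficients of (s - e) Q = s Q - e Q: splitting the masks on their first bit, [e] is either
    skipped or heads the word. *)
Lemma esym_cons e p k w : Defs.esym F (e :: p) k w = Defs.esym F p k w -
  (if (k, w) is (k'.+1, e' :: w') then (e' == e)%:R * Defs.esym F p k' w' else 0).
Proof.
rewrite /Defs.esym big_mkcond.
rewrite (sum_tupleS (fun m => if (count id m == k) && (mask m (e :: p) == w) then 1 else 0)).
rewrite big_bool /= addrC mulrDr -!big_mkcond /=; congr (_ + _).
case: k w => [|k] [|e' w] /=.
- by rewrite big_pred0 ?mulr0 ?subr0 ?oppr0 // => m; rewrite andbF.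
- by rewrite big_pred0 ?mulr0 ?oppr0 // => m; rewrite add1n.
- by rewrite big_pred0 ?mulr0 ?oppr0 // => m; rewrite andbF.
rewrite exprS mulN1r mulNr; congr (- _); rewrite mulrCA; congr (_ * _).
rewrite (eq_sym e'); case: (e =P e') => [->|ne]; last first.
  rewrite mul0r big_pred0 // => m; rewrite eqseq_cons.
  by case: (e =P e') => // _; rewrite andbF.
by rewrite mul1r; apply: eq_bigl => m; rewrite eqseq_cons eqxx.
Qed.

Lemma esym_nil k w : Defs.esym F ([::] : seq E) k w = ((k == 0%N) && (w == [::]))%:R.
Proof.
rewrite /Defs.esym big_mkcond /=.
rewrite (sum_tuple0 (fun m => if (count id m == k) && (mask m [::] == w) then 1 else 0)) /=.
by case: k w => [|k] [|e w]; rewrite /= ?expr0 ?mulr1 ?mulr0.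
Qed.

Lemma esym0 p w : Defs.esym F p 0 w = (w == [::])%:R.
Proof. by elim: p => [|e p IH]; rewrite ?esym_nil // esym_cons IH subr0. Qed.

Lemma sum_esym1 alpha p :
  \sum_(e : E) alpha e * Defs.esym F p 1 [:: e] = - \sum_(e <- p) alpha e.
Proof.
elim: p => [|e0 p IH].
  by rewrite big_nil oppr0 big1 // => e _; rewrite esym_nil mulr0.
rewrite big_cons opprD addrC -IH; under eq_bigr do rewrite esym_cons esym0 mulrBr mulr1.
rewrite sumrB; congr (_ - _); rewrite (bigD1 e0) //= eqxx mulr1 big1 ?addr0 // => e.
by move/negPf->; rewrite mulr0.
Qed.

(** The sum of alpha(e_i) beta(e_j) over i < j, that is, the functional alpha tensor beta on
    e(p,2). *)
Fixpoint pairsum alpha beta p : F :=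
  if p is e :: p' then alpha e * (\sum_(e' <- p') beta e') + pairsum alpha beta p' else 0.

Lemma sum_esym2 alpha beta p :
  \sum_(e : E) \sum_(e' : E) alpha e * beta e' * Defs.esym F p 2 [:: e; e'] =
  pairsum alpha beta p.
Proof.
elim: p => [|e0 p IH] /=.
  by rewrite big1 // => e _; rewrite big1 // => e' _; rewrite esym_nil mulr0.
rewrite -[\sum_(e' <- p) _]opprK -sum_esym1 addrC -IH mulrN.
under eq_bigr do under eq_bigr do rewrite esym_cons mulrBr.
under eq_bigr do rewrite sumrB.
rewrite sumrB; congr (_ - _); rewrite (bigD1 e0) //= [X in _ + X]big1 ?addr0 => [|e].
  by rewrite mulr_sumr; apply: eq_bigr => e' _; rewrite eqxx mul1r -mulrA.
by move/negPf->; rewrite big1 // => e' _; rewrite mul0r mulr0.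
Qed.

(** The gradient of a potential [A] on the vertices: its sum along a path depends only on the
    endpoints. *)
Definition drop_along A (e : E) : F := A (src e) - A (tgt e).

Lemma is_pathb_cons b a e p : is_pathb b a (e :: p) =
  (src e == b) && (if p is [::] then tgt e == a else is_pathb (tgt e) a p).
Proof.
case: p => [|e' p] /=; first by rewrite andbT.
by rewrite (eq_sym (src e')); congr (_ && _); exact: andbCA.
Qed.

Lemma path_sum A b a p : is_pathb b a p -> \sum_(e <- p) drop_along A e = A b - A a.
Proof.
elim: p b => // e p IH b; rewrite is_pathb_cons big_cons /drop_along => /andP[/eqP <-].
case: p IH => [_ /eqP <-|e' p IH /IH ->]; first by rewrite big_nil addr0.
by ring.
Qed.

(** For each edge [e] the later drops of [B] telescope to [B (tgt e) - B a]. Multiplied by the drop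
    of [A], the first term is a drop of [C] and the second telescopes with [A]. *)
Lemma path_pairsum A B C b a p :
  (forall e, drop_along A e * B (tgt e) = drop_along C e) -> is_pathb b a p ->
  pairsum (drop_along A) (drop_along B) p = C b - C a - (A b - A a) * B a.
Proof.
move=> ABC; elim: p b => // e p IH b; rewrite is_pathb_cons => /andP[/eqP <-] /=.
have -> : C (src e) = drop_along A e * B (tgt e) + C (tgt e) by rewrite ABC subrK.
case: p IH => [_ /eqP <-|e' p IH pP]; first by rewrite big_nil /drop_along /=; ring.
by rewrite (path_sum B pP) (IH _ pP) /drop_along; ring.
Qed.

(** The pure tensor of the functionals [fs], evaluated on words of the same length. *)
Definition prodf (fs : seq (E -> F)) w : F := \prod_(x <- zip fs w) x.1 x.2.

Lemma prodf_cat fs gs u v : size fs = size u ->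
  prodf (fs ++ gs) (u ++ v) = prodf fs u * prodf gs v.
Proof. by move=> sz; rewrite /prodf zip_cat // big_cat. Qed.

Lemma prodf_cons f fs e w : prodf (f :: fs) (e :: w) = f e * prodf fs w.
Proof. exact: big_cons. Qed.

Lemma prodf_nil w : prodf [::] w = 1.
Proof. by rewrite /prodf; case: w => [|e w]; rewrite big_nil. Qed.

(** By homogeneity only the relations of degree j - |u| - |v| have a multiple in degree [j], and
    e(p,0) = 1 for every path; positive degrees remain. *)
Lemma Ideal_annihilated j (phi : seq E -> F) :
  (forall u v m b a p p', j = (size u + m.+1 + size v)%N ->
     is_pathb b a p -> is_pathb b a p' ->
     \sum_(t : m.+1.-tuple E) phi (u ++ t ++ v) * Defs.esym F p m.+1 t =
     \sum_(t : m.+1.-tuple E) phi (u ++ t ++ v) * Defs.esym F p' m.+1 t) ->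
  (Id j <= lker (pairingL (fun w : j.-tuple E => phi w)))%VS.
Proof.
move=> H; apply: Ideal_ind => u v b a p p' k pP pP' _ _ _ _ _.
rewrite memv_ker pairingLE; have [uvj|/tvec_oversize->] := leqP (size u + size v) j; last first.
  by rewrite -pairingLE linear0.
have jE : j = (size u + (j - size u - size v) + size v)%N by lia.
rewrite (pairing_tvec _ _ jE); move: (j - size u - size v)%N jE => m jE.
rewrite /esymB; under eq_bigr do rewrite mulrBr.
rewrite sumrB subr_eq0; apply/eqP; have [<-|mk] := eqVneq m k; last first.
  by apply: eq_bigr => t _; rewrite !esym_size // size_tuple.
case: m jE => [|m] jE; last exact: (H _ _ _ b a).
by apply: eq_bigr => t _; rewrite !esym0.
Qed.

Lemma Ideal1_annihilated A :
  (Id 1 <= lker (pairingL (fun w : 1.-tuple E => prodf [:: drop_along A] w)))%VS.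
Proof.
apply: Ideal_annihilated => -[|? ?] [|? ?] [|m] b a p p' //= jE pP pP'; try lia.
have S q : is_pathb b a q -> \sum_(t : 1.-tuple E)
    prodf [:: drop_along A] (t ++ [::]) * Defs.esym F q 1 t = A a - A b.
  move=> qP; rewrite (sum_tupleS (fun t =>
    prodf [:: drop_along A] (t ++ [::]) * Defs.esym F q 1 t)).
  under eq_bigr => e _.
    rewrite (sum_tuple0 (fun t =>
      prodf [:: drop_along A] ((e :: t) ++ [::]) * Defs.esym F q 1 (e :: t))).
    rewrite prodf_cons prodf_nil mulr1.
  over.
  by rewrite sum_esym1 (path_sum A qP) opprB.
by rewrite !S.
Qed.

(* A quadratic functional [drop_along A (x) drop_along B] takes the value
   [sum_(i < j) (A x_(i-1) - A x_i) (B x_(j-1) - B x_j)] on [e(pi,2)]; the inner sum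
   telescopes, and so does the outer one when [C] is a potential for it. *)
Lemma Ideal2_annihilated A B C :
  (forall e : E, drop_along A e * B (tgt e) = drop_along C e) ->
  (Id 2 <= lker (pairingL (fun w : 2.-tuple E => prodf [:: drop_along A; drop_along B] w)))%VS.
Proof.
move=> ABC; set phi := prodf _.
have S1 (f : seq E -> F) c D b a p : (forall e, f [:: e] = c * drop_along D e) ->
    is_pathb b a p ->
    \sum_(t : 1.-tuple E) f t * Defs.esym F p 1 t = c * (D a - D b).
  move=> fE pP; rewrite (sum_tupleS (fun t => f t * Defs.esym F p 1 t)).
  rewrite -opprB -(path_sum D pP) -sum_esym1 mulr_sumr; apply: eq_bigr => e _.
  by rewrite (sum_tuple0 (fun t => f (e :: t) * Defs.esym F p 1 (e :: t))) fE mulrA.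
apply: Ideal_annihilated => u v m b a p p' jE pP pP'.
(* In degree 2 there is either a linear relation with one edge as left or right factor, or a
   quadratic relation alone. *)
case: m jE => [|[|m]] jE; last by lia.
- case: u v jE => [|e [|? ?]] [|e' [|? ?]] //= jE; try lia.
    rewrite !(S1 (fun t => phi (t ++ [:: e'])) (drop_along B e') A b a) // => e;
    by rewrite /phi !prodf_cons prodf_nil mulr1 mulrC.
  rewrite !(S1 (fun t => phi (e :: t ++ [::])) (drop_along A e) B b a) // => e';
  by rewrite /phi !prodf_cons prodf_nil mulr1.
- case: u v jE => [|? ?] [|? ?] //= jE; try lia.
have S q : is_pathb b a q -> \sum_(t : 2.-tuple E)
    phi (t ++ [::]) * Defs.esym F q 2 t = C b - C a - (A b - A a) * B a.
  move=> qP; rewrite (sum_tupleS (fun t => phi (t ++ [::]) * Defs.esym F q 2 t)).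
  rewrite -(path_pairsum ABC qP) -sum_esym2; apply: eq_bigr => e _.
  rewrite (sum_tupleS (fun t => phi ((e :: t) ++ [::]) * Defs.esym F q 2 (e :: t))).
  apply: eq_bigr => e' _.
  rewrite (sum_tuple0 (fun t => phi ([:: e, e' & t] ++ [::]) * Defs.esym F q 2 [:: e, e' & t])).
  by rewrite /phi !prodf_cons prodf_nil mulr1.
by rewrite !S.
Qed.

End PathSums.

(** * The bar complex in internal degree 3 *)

Definition s0 : 'I_3 := @Ordinal 3 0 isT.
Definition s1 : 'I_3 := @Ordinal 3 1 isT.
Definition s2 : 'I_3 := @Ordinal 3 2 isT.
(** The cut sets [set0], [cut1], [cut2], [cut12] encode the compositions 3, 1+2, 2+1 and 1+1+1. *)
Definition cut1 : {set 'I_3} := [set s1].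
Definition cut2 : {set 'I_3} := [set s2].
Definition cut12 : {set 'I_3} := [set s1; s2].

Lemma big_I3 (R : Type) (idx : R) (op : Monoid.law idx) (P : pred 'I_3) (G : 'I_3 -> R) :
  \big[op/idx]_(s | P s) G s =
  op (if P s0 then G s0 else idx) (op (if P s1 then G s1 else idx) (if P s2 then G s2 else idx)).
Proof.
rewrite big_mkcond !big_ord_recl big_ord0 Monoid.mulm1.
have -> : lift ord0 (lift ord0 ord0) = s2 by apply: val_inj.
have -> : lift ord0 ord0 = s1 by apply: val_inj.
by have -> : ord0 = s0 by apply: val_inj.
Qed.

Lemma card_I3 (P : pred 'I_3) : #|[set t | P t]| = (P s0 + (P s1 + P s2))%N.
Proof. by rewrite cardsE -sum1_card big_I3 /= /in_mem /=; do 3!case: (P _). Qed.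

Lemma validS3 (S : {set 'I_3}) : validS S -> S \in [:: set0; cut1; cut2; cut12].
Proof.
move=> /forallP/(_ s0)/implyP S0.
have {S0} S0 : (s0 \in S) = false by apply/negP => /S0.
have E3 (A B : {set 'I_3}) : (s0 \in A) = (s0 \in B) -> (s1 \in A) = (s1 \in B) ->
    (s2 \in A) = (s2 \in B) -> A = B.
  move=> e0 e1 e2; apply/setP => -[[|[|[|//]]] i].
  - by have -> : Ordinal i = s0 by apply: val_inj.
  - by have -> : Ordinal i = s1 by apply: val_inj.
  - by have -> : Ordinal i = s2 by apply: val_inj.
case i1: (s1 \in S); case i2: (s2 \in S).
- by rewrite (E3 S cut12) ?inE ?eqxx ?orbT // S0 i1 i2 !inE.
- by rewrite (E3 S cut1) ?inE ?eqxx ?orbT // S0 i1 i2 !inE.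
- by rewrite (E3 S cut2) ?inE ?eqxx ?orbT // S0 i1 i2 !inE.
- by rewrite (E3 S set0) ?inE ?eqxx ?orbT // S0 i1 i2 !inE.
Qed.

Lemma valid_cuts : [/\ validS (set0 : {set 'I_3}), validS cut1, validS cut2 & validS cut12].
Proof.
split; apply/forallP => s; apply/implyP; rewrite !inE //.
- by move/eqP->.
- by move/eqP->.
- by case/orP=> /eqP->.
Qed.

Lemma cut_eq : [/\ (cut1 == set0) = false, (cut2 == set0) = false, (cut12 == set0) = false,
  (set0 == cut1) = false & (set0 == cut2) = false] /\ 
  [/\ (cut1 == cut2) = false, (cut2 == cut1) = false,
  (cut12 == cut1) = false & (cut12 == cut2) = false].
Proof.
have D (A B : {set 'I_3}) s : (s \in A) != (s \in B) -> (A == B) = false.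
  by move=> /eqP ne; apply/eqP => AB; apply: ne; rewrite AB.
by split; split; first [by apply: (D _ _ s1); rewrite !inE | by apply: (D _ _ s2); rewrite !inE].
Qed.

Lemma card_cuts : [/\ #|set0 : {set 'I_3}| = 0%N, #|cut1| = 1%N, #|cut2| = 1%N & #|cut12| = 2%N].
Proof. by rewrite cards0 !cards1 cards2. Qed.

Lemma isblock0 p q : isblock (set0 : {set 'I_3}) (p, q) = ((p == 0) && (q == 3))%N.
Proof.
have c n : cutn (set0 : {set 'I_3}) n = false by apply/existsP => -[s]; rewrite inE.
rewrite /isblock !c !orbF /=.
have -> : [forall s in set0 : {set 'I_3}, ~~ (p < s < q)%N] by apply/forallP => s; rewrite inE.
by case: p q => [|p] [|[|[|[|q]]]] //=; rewrite andbF.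
Qed.

Lemma isblock1 (s : 'I_3) p q : isblock [set s] (p, q) =
  [&& (p < q <= 3)%N, (p == 0%N) || (p == s), (q == 3%N) || (q == s) & ~~ (p < s < q)%N].
Proof.
have c n : cutn [set s] n = (n == s).
  apply/existsP/eqP => [[x]|->]; first by rewrite inE => /andP[/eqP -> /eqP ->].
  by exists s; rewrite inE !eqxx.
rewrite /isblock !c /=; do 3!congr (_ && _).
apply/forallP/idP => [/(_ s)/implyP|H x]; first by apply; rewrite inE.
by apply/implyP; rewrite inE => /eqP ->.
Qed.

Section BarComplex.
Variables (F : fieldType) (T : finType) (le : rel T) (rk : T -> nat).
Local Notation E := (edge le rk).
Local Notation Ts := (Tsp F le rk).
Local Notation Vs := (Vsp F le rk).
Implicit Types (u v : seq E).

Definition emb j (S : {set 'I_j}) : 'Hom(Ts j, Vs j) :=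
  linfun (fun t : Ts j => 
    [ffun y : {set 'I_j} * j.-tuple E => if y.1 == S then t y.2 else 0] : Vs j).

Definition part j (S : {set 'I_j}) : 'Hom(Vs j, Ts j) :=
  linfun (fun x : Vs j => [ffun w : j.-tuple E => x (S, w)] : Ts j).

Lemma embE j (S : {set 'I_j}) t y : emb S t y = if y.1 == S then t y.2 else 0.
Proof.
rewrite linfunE ?ffunE // => a g h; apply/ffunP => z; rewrite !ffunE.
by case: ifP; rewrite ?ffunE // scaler0 addr0.
Qed.

Lemma partE j (S : {set 'I_j}) x w : part S x w = x (S, w).
Proof. by rewrite linfunE ?ffunE // => a g h; apply/ffunP => z; rewrite !ffunE. Qed.

Lemma part_emb j (S S' : {set 'I_j}) t : part S (emb S' t) = if S == S' then t else 0.
Proof. by apply/ffunP => w; rewrite partE embE /=; case: ifP; rewrite ?ffunE. Qed.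

Lemma pairing_emb j (S : {set 'I_j}) (phi : Vs j) t :
  @pairing F _ phi (emb S t) = @pairing F _ (part S phi) t.
Proof.
rewrite /pairing (eq_bigr (fun y => phi (y.1, y.2) * (if y.1 == S then t y.2 else 0))).
  rewrite -(pair_bigA _ (fun S' w => phi (S', w) * (if S' == S then t w else 0))) /=.
  rewrite (bigD1 S) //= [X in _ + X]big1 ?addr0 => [|S' /negPf SS'].
    by apply: eq_bigr => w _; rewrite partE eqxx.
  by rewrite big1 // => w _; rewrite SS' mulr0.
by move=> [S' w] _; rewrite embE.
Qed.

Lemma pairing_sym (I : finType) (phi psi : {ffun I -> F^o}) :
  @pairing F _ phi psi = @pairing F _ psi phi.
Proof. by apply: eq_bigr => x _; rewrite mulrC. Qed.

Section Relations.
Variable J : forall k, {vspace Ts k}.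
Local Notation K := (Kc J).

Lemma kvecE j (S : {set 'I_j}) k u (g : Ts k) v : kvec S u g v = emb S (tmul j u g v).
Proof. by apply/ffunP => y; rewrite embE !ffunE. Qed.

Lemma Kc_gen j (S : {set 'I_j}) p q u v (g : Ts (q - p)) :
  validS S -> isblock S (p, q) -> (q <= j)%N -> size u = p -> size v = (j - q)%N ->
  g \in J (q - p) -> emb S (tmul j u g v) \in K j.
Proof.
move=> vS bS qj su sv gJ.
have /(tmul_sub)/(_ g gJ) : (J (q - p) <= linfun (fun g : Ts (q - p) => tmul j u g v)
    @^-1: (emb S @^-1: K j))%VS.
  rewrite -(span_basis (vbasisP (J (q - p)))); apply: span_ind => h hJ.
  rewrite -memv_preim linfunE; last exact: tmul_linear.
  rewrite -memv_preim -kvecE; apply: memv_span.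
  apply/flatten_mapP; exists S; first by rewrite mem_enum.
  apply/flatten_mapP; exists (p, q).
    rewrite mem_filter bS; apply/allpairsP; exists (p, q).
    by case/and4P: bS => pq _ _ _; move: pq; rewrite !mem_iota; split=> //; simpl in *; lia.
  apply/flatten_mapP; exists (u, v).
    by apply/allpairsP; exists (u, v); rewrite !mem_words su sv !eqxx.
  by apply/mapP; exists h.
by rewrite -memv_preim.
Qed.

Lemma Kc_ind j (V : {vspace Vs j}) :
  (forall (S : {set 'I_j}) p q u v (g : Ts (q - p)),
    validS S -> isblock S (p, q) -> (q <= j)%N -> size u = p -> size v = (j - q)%N ->
    g \in J (q - p) -> emb S (tmul j u g v) \in V) ->
  (K j <= V)%VS.
Proof.
move=> H; apply: span_ind => x /flatten_mapP[S + /flatten_mapP[[p q] + /flatten_mapP[[u v]]]].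
rewrite mem_enum mem_filter => vS /andP[bS /allpairsP[[p' q']]] [_ + [_ qE]].
rewrite mem_iota -{q'}qE => /andP[_ qj] /allpairsP[[u' v']] [] + + [uE vE].
rewrite -{u'}uE -{v'}vE !mem_words => /eqP su /eqP sv /mapP[g gJ ->].
by rewrite kvecE; apply: H => //; apply: vbasis_mem.
Qed.

(** Each generator of [K] is supported on one cut set, so [K] is the direct sum of its
    components. *)
Lemma Kc_part j (S : {set 'I_j}) x : x \in K j -> emb S (part S x) \in K j.
Proof.
suff /subvP KS : (K j <= part S @^-1: (emb S @^-1: K j))%VS by move/KS; rewrite -!memv_preim.
apply: Kc_ind => S' p q u v g vS bS qj su sv gJ; rewrite -!memv_preim part_emb.
by case: eqP => [->|_]; rewrite ?linear0 ?rpred0 // (Kc_gen vS bS).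
Qed.

End Relations.

Local Notation P := (Pc F le rk 3).
Local Notation D := (Dbar F le rk 3).
Local Notation D' := (Dcobar F le rk 3).

Lemma PcP i (x : Vs 3) :
  reflect (forall y, ~~ (validS y.1 && (#|y.1|.+1 == i)%N) -> x y = 0) (x \in P i).
Proof.
exact: (mem_span_delta (fun y : {set 'I_3} * 3.-tuple E => validS y.1 && (#|y.1|.+1 == i)%N)).
Qed.

Lemma emb_Pc (S : {set 'I_3}) t : validS S -> emb S t \in P #|S|.+1.
Proof.
move=> vS; apply/PcP => -[S' w] /= ne; rewrite embE /=; case: eqP => // S'S.
by move: ne; rewrite S'S vS eqxx.
Qed.

Lemma Pc1E x : x \in P 1 -> x = emb set0 (part set0 x).
Proof.
move/PcP => x0; apply/ffunP => -[S w]; rewrite embE partE /=; case: eqP => [-> //|ne].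
by rewrite x0 //= eqSS cards_eq0; case: (validS S) => //; apply/eqP.
Qed.

Lemma Pc2E x : x \in P 2 -> x = emb cut1 (part cut1 x) + emb cut2 (part cut2 x).
Proof.
move/PcP => x0; apply/ffunP => -[S w]; rewrite ffunE !embE !partE /=.
have [[_ _ _ _ _] [e12 e21 _ _]] := cut_eq.
case: (eqVneq S cut1) => [->|n1]; first by rewrite e12 addr0.
case: (eqVneq S cut2) => [->|n2]; first by rewrite add0r.
rewrite addr0 x0 //=; apply/andP => -[/validS3]; rewrite !inE (negPf n1) (negPf n2) /=.
by case: card_cuts => c0 _ _ c2 /orP[] /eqP->; rewrite ?c0 ?c2.
Qed.

Lemma Pc3E x : x \in P 3 -> x = emb cut12 (part cut12 x).
Proof.
move/PcP => x0; apply/ffunP => -[S w]; rewrite embE partE /=; case: eqP => [-> //|ne].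
rewrite x0 //=; apply/andP => -[/validS3]; rewrite !inE; move/eqP: ne => /negPf->; rewrite orbF.
by case: card_cuts => c0 c1 c2 _ /or3P[] /eqP->; rewrite ?c0 ?c1 ?c2.
Qed.

Lemma DbarE x y : D x y = \sum_(s : 'I_3 | (s \notin y.1) && (0 < val s)%N)
  (-1) ^+ #|[set t in y.1 | (val t < val s)%N]| * x (s |: y.1, y.2).
Proof.
rewrite linfunE ?ffunE // => a v u; apply/ffunP => z.
rewrite !ffunE /GRing.scale /= mulr_sumr -big_split.
by apply: eq_bigr => s _; rewrite !ffunE /= mulrDr; congr (_ + _); rewrite /GRing.scale /= mulrCA.
Qed.

Lemma Dbar_emb (S : {set 'I_3}) t : D (emb S t) =
  \sum_(s in S | (0 < val s)%N) (-1) ^+ #|[set r in S :\ s | (val r < val s)%N]| *: emb (S :\ s) t.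
Proof.
apply/ffunP => -[Y w]; rewrite DbarE sum_ffunE /= big_mkcond [RHS]big_mkcond.
apply: eq_bigr => s _; rewrite !ffunE !embE /= [in RHS]andbC.
case: (val s > 0)%N; rewrite ?andbF ?andbT //=.
case: (boolP (s \in S)) => sS; case: (boolP (s \in Y)) => sY //=.
- by case: eqP => YS; rewrite ?scaler0 //; move: sY; rewrite YS !inE eqxx.
- have -> : (s |: Y == S) = (Y == S :\ s).
    by apply/eqP/eqP => [<-|->]; rewrite ?setU1K ?setD1K.
  by case: eqP => [->//|_]; rewrite mulr0 scaler0.
- by case: eqP => [YS|]; rewrite ?mulr0 //; case/negP: sS; rewrite -YS !inE eqxx.
Qed.

(** The ambient complex is T_3 -> T_3 + T_3 -> T_3, with t going to (-t, t) and (s, t) to s + t; the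
    relations enter only through [Kc]. *)
Lemma Dbar_cut1 t : D (emb cut1 t) = emb set0 t.
Proof.
rewrite Dbar_emb big_I3 !inE /= !add0r addr0 setDv card_I3 !inE /=.
by rewrite expr0 scale1r.
Qed.

Lemma Dbar_cut2 t : D (emb cut2 t) = emb set0 t.
Proof.
rewrite Dbar_emb big_I3 !inE /= !add0r setDv card_I3 !inE /=.
by rewrite expr0 scale1r.
Qed.

Lemma Dbar_cut12 t : D (emb cut12 t) = emb cut2 t - emb cut1 t.
Proof.
rewrite Dbar_emb big_I3 !inE /= !add0r.
have -> : cut12 :\ s1 = cut2 by rewrite /cut12 setU1K ?inE.
have -> : cut12 :\ s2 = cut1 by rewrite /cut12 setUC setU1K ?inE.
by rewrite !card_I3 !inE /= expr0 scale1r expr1 scaleN1r.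
Qed.

Lemma DcobarE phi y : D' phi y = if validS y.1 then
  \sum_(s in y.1) (-1) ^+ #|[set t in y.1 | (val t < val s)%N]| * phi (y.1 :\ s, y.2) else 0.
Proof.
rewrite linfunE ?ffunE // => a v u; apply/ffunP => z; rewrite !ffunE.
case: ifP => _; last by rewrite scaler0 addr0.
rewrite /GRing.scale /= mulr_sumr -big_split.
by apply: eq_bigr => s _; rewrite !ffunE /= mulrDr; congr (_ + _); rewrite /GRing.scale /= mulrCA.
Qed.

(** The transposed complex: t goes to (t, t), and (s, t) to t - s. *)
Lemma Dcobar_cut1 phi : part cut1 (D' phi) = part set0 phi.
Proof.
apply/ffunP => w; rewrite !partE DcobarE /=; case: valid_cuts => _ -> _ _.
by rewrite big_I3 !inE /= setDv card_I3 !inE /= expr0 mul1r addr0 add0r.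
Qed.

Lemma Dcobar_cut2 phi : part cut2 (D' phi) = part set0 phi.
Proof.
apply/ffunP => w; rewrite !partE DcobarE /=; case: valid_cuts => _ _ -> _.
by rewrite big_I3 !inE /= setDv card_I3 !inE /= expr0 mul1r !add0r.
Qed.

Lemma Dcobar_cut12 phi : part cut12 (D' phi) = part cut2 phi - part cut1 phi.
Proof.
apply/ffunP => w; rewrite !ffunE !partE DcobarE /=; case: valid_cuts => _ _ _ ->.
rewrite big_I3 !inE /= !add0r.
have -> : cut12 :\ s1 = cut2 by rewrite /cut12 setU1K ?inE.
have -> : cut12 :\ s2 = cut1 by rewrite /cut12 setUC setU1K ?inE.
by rewrite !card_I3 !inE /= expr0 mul1r expr1 mulN1r.
Qed.

Lemma Dcobar_set0 phi : part set0 (D' phi) = 0.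
Proof.
by apply/ffunP => w; rewrite !ffunE !partE DcobarE /= big_set0 if_same.
Qed.

End BarComplex.

Arguments emb {F T le rk j} S.
Arguments part {F T le rk j} S.

(** Subtraction on [nat] is truncated, so telescoping relies on monotonicity. *)
Lemma telescope_le (a : nat -> nat) N : (forall n, a n <= a n.+1)%N ->
  (\sum_(n < N.+1) (a n - (if val n is n'.+1 then a n' else 0)) = a N)%N.
Proof.
move=> a_le; elim: N => [|N IH]; first by rewrite big_ord_recr big_ord0 /= subn0.
by rewrite big_ord_recr IH /= subnKC.
Qed.

Lemma telescope_ge (a : nat -> nat) N : (forall n, a n.+1 <= a n)%N ->
  (\sum_(n < N) (a n - a n.+1) + a N = a 0)%N.
Proof.
move=> a_le; elim: N => [|N IH]; first by rewrite big_ord0.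
by rewrite big_ord_recr -addnA subnK.
Qed.

(** * Tor and Ext in bidegree (2, 3) for a family of relation spaces *)

Section Homology.
Variables (F : fieldType) (T : finType) (le : rel T) (rk : T -> nat).
Local Notation E := (edge le rk).
Local Notation Ts := (Tsp F le rk).
Local Notation Vs := (Vsp F le rk).
Local Notation P := (Pc F le rk 3).
Local Notation D := (Dbar F le rk 3).
Local Notation D' := (Dcobar F le rk 3).
Variable J : forall k, {vspace Ts k}.


Local Notation K := (Kc J 3).

(* [J_1 T_2 + T_1 J_2 + J_2 T_1 + T_2 J_1] *)
Definition decomposable : {vspace Ts 3} :=
  (part cut1 @: K + part cut2 @: K)%VS.

Lemma decomposable_ind (V : {vspace Ts 3}) :
  (forall k u v (g : Ts k), (size u, k, size v) \in
     [:: (0, 1, 2); (1, 2, 0); (0, 2, 1); (2, 1, 0)]%N ->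
   g \in J k -> tmul 3 u g v \in V) -> (decomposable <= V)%VS.
Proof.
move=> H; rewrite subv_add; apply/andP; split; apply/subvP => _ /memv_imgP[x xK ->];
  rewrite memv_preim; apply/subvP: x xK; apply: Kc_ind => S p q u v g vS bS qj su sv gJ;
  rewrite -memv_preim part_emb; case: eqP => [SE|_]; rewrite ?rpred0 //; apply: H => //;
  (* The blocks are [0,1) and [1,3) for [cut1], [0,2) and [2,3) for [cut2]; these give the four
     triples. *)
  move: bS; rewrite -SE isblock1 su sv !inE !xpair_eqE;
  have [e1 e2] : nat_of_ord s1 = 1%N /\ nat_of_ord s2 = 2%N by []; lia.
Qed.

Lemma mem_decomposable k u v (g : Ts k) : (size u, k, size v) \in
     [:: (0, 1, 2); (1, 2, 0); (0, 2, 1); (2, 1, 0)]%N ->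
   g \in J k -> tmul 3 u g v \in decomposable.
Proof.
have [_ v1 v2 _] := valid_cuts.
have Dc S p q : validS S -> isblock S (p, q) -> (q <= 3)%N ->
    forall u v (g : Ts (q - p)), size u = p -> size v = (3 - q)%N -> g \in J (q - p) ->
    tmul 3 u g v \in (part S @: K)%VS.
  move=> vS bS q3 u' v' g' su sv gJ.
  have -> : tmul 3 u' g' v' = part S (emb S (tmul 3 u' g' v')) by rewrite part_emb eqxx.
  by apply: memv_img; apply: (Kc_gen vS bS).
have sub1 := subvP (addvSl (part cut1 @: K) (part cut2 @: K)).
have sub2 := subvP (addvSr (part cut1 @: K) (part cut2 @: K)).
rewrite !inE => /or4P[] /eqP[su kE sv] gJ; subst k.
- by apply/sub1/(Dc _ 0 1); rewrite ?isblock1.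
- by apply/sub1/(Dc _ 1 3); rewrite ?isblock1.
- by apply/sub2/(Dc _ 0 2); rewrite ?isblock1.
- by apply/sub2/(Dc _ 2 3); rewrite ?isblock1.
Qed.

(** Without cuts the only block is [0,3), flanked by empty words. *)
Lemma part0_Kc : (part set0 @: K)%VS = J 3.
Proof.
have tmul0 (g : Ts 3) : tmul 3 [::] g [::] = g.
  apply/ffunP => w; rewrite ffunE -[RHS]extT_tval.
  by have := ins_val_cat [::] (extT g) [::] w; rewrite cat0s cats0.
apply/eqP; rewrite eqEsubv; apply/andP; split; apply/subvP => x.
  case/memv_imgP => y yK ->; rewrite memv_preim; apply/subvP: y yK.
  apply: Kc_ind => S p q u v g vS bS qj su sv gJ; rewrite -memv_preim part_emb.
  case: eqP => [SE|_]; rewrite ?rpred0 //; move: bS g gJ su sv; rewrite -SE isblock0.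
  by case/andP=> /eqP-> /eqP-> g gJ /size0nil-> /size0nil->; rewrite (tmul0 g).
move=> xJ; have -> : x = part set0 (emb set0 (tmul 3 [::] x [::])).
  by rewrite part_emb eqxx tmul0.
have [v0 _ _ _] := valid_cuts.
by apply: memv_img; apply: (@Kc_gen F T le rk J 3 set0 0 3); rewrite ?isblock0.
Qed.

Lemma emb_inj (S : {set 'I_3}) (U : {vspace Ts 3}) : \dim (emb S @: U) = \dim U.
Proof.
apply: limg_dim_eq; apply/eqP; rewrite -subv0; apply/subvP => t.
rewrite memv_cap memv_ker memv0 => /andP[_ /eqP/(congr1 (part S))].
by rewrite part_emb eqxx linear0 => ->.
Qed.

Lemma emb0_Kc t : (emb set0 t \in K) = (t \in J 3).
Proof.
apply/idP/idP => [/(memv_img (part set0))|]; first by rewrite part_emb eqxx part0_Kc.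
by rewrite -part0_Kc => /memv_imgP[x xK ->]; apply: Kc_part.
Qed.

Local Notation Z := (Zc J 3 2).
Local Notation B := (Bc J 3 2).

Lemma Dbar_Pc2 x : x \in P 2 -> D x = emb set0 (part cut1 x + part cut2 x).
Proof. by move/Pc2E => {1}->; rewrite !linearD /= Dbar_cut1 Dbar_cut2. Qed.

Lemma cut_Pc : [/\ forall t, emb set0 t \in P 1, forall t, emb cut1 t \in P 2,
  forall t, emb cut2 t \in P 2 & forall t, emb cut12 t \in P 3].
Proof.
have [v0 v1 v2 v12] := valid_cuts; have [c0 c1 c2 c12] := card_cuts.
have emP S t i : validS S -> #|S|.+1 = i -> emb S t \in P i by move=> vS <-; apply: emb_Pc.
by split=> t; apply: emP; rewrite ?c0 ?c1 ?c2 ?c12.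
Qed.

(** Exactness of the ambient complex in the middle: the kernel of addition is the antidiagonal. *)
Lemma Dbar_Pc3 : (D @: P 3)%VS = (P 2 :&: lker D)%VS.
Proof.
have [i0 i1 i2 i12] := cut_Pc.
apply/eqP; rewrite eqEsubv; apply/andP; split; apply/subvP => x.
  case/memv_imgP=> y /Pc3E -> ->; rewrite Dbar_cut12 memv_cap rpredB //=.
  by rewrite memv_ker linearB /= Dbar_cut1 Dbar_cut2 subrr.
rewrite memv_cap memv_ker => /andP[xP]; rewrite (Dbar_Pc2 xP) => /eqP/(congr1 (part set0)).
rewrite part_emb eqxx linear0 => /eqP; rewrite addr_eq0 => /eqP x1.
rewrite (Pc2E xP) x1 linearN addrC -Dbar_cut12; exact: memv_img.
Qed.

Lemma Bc_Pc2 : (B <= P 2)%VS.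
Proof. by rewrite subv_add Dbar_Pc3 capvSl capvSr. Qed.

(** Boundaries from [P 3] die under [D]. On [K] the map [D] adds the components at [cut1] and
    [cut2], which vary independently by [Kc_part]. *)
Lemma Dbar_Bc : (D @: B)%VS = (emb set0 @: decomposable)%VS.
Proof.
have [i0 i1 i2 i12] := cut_Pc.
have -> : (D @: B)%VS = (D @: (K :&: P 2))%VS.
  rewrite limgD Dbar_Pc3 (_ : D @: (P 2 :&: lker D) = 0)%VS ?add0v //.
  by apply/eqP; rewrite -lkerE capvSr.
apply/eqP; rewrite eqEsubv; apply/andP; split; apply/subvP => x.
  case/memv_imgP=> y; rewrite memv_cap => /andP[yK yP] ->; rewrite (Dbar_Pc2 yP).
  by apply: memv_img; apply: memv_add; apply: memv_img.
case/memv_imgP=> t /memv_addP[t1 /memv_imgP[y1 y1K ->] [t2 /memv_imgP[y2 y2K ->] ->]] ->.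
rewrite linearD /= -Dbar_cut1 -Dbar_cut2 -linearD; apply: memv_img.
by rewrite memv_cap !rpredD ?Kc_part.
Qed.

Lemma Dbar_Zc : (D @: Z)%VS = (emb set0 @: J 3)%VS.
Proof.
have [i0 i1 i2 i12] := cut_Pc.
apply/eqP; rewrite eqEsubv; apply/andP; split; apply/subvP => x.
  case/memv_imgP=> y; rewrite memv_cap -memv_preim => /andP[yP + ->]; rewrite (Dbar_Pc2 yP).
  by rewrite emb0_Kc; apply: memv_img.
case/memv_imgP=> t tJ ->; rewrite -Dbar_cut1; apply: memv_img.
by rewrite memv_cap i1 -memv_preim Dbar_cut1 emb0_Kc.
Qed.

(** [Z] and [B] both contain the kernel of [D] on [P 2], so they differ only through their images,
    [J 3] and [decomposable]. *)
Lemma dim_Zc : \dim Z = (\dim (P 2 :&: lker D) + \dim (J 3))%N.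
Proof.
rewrite -(limg_ker_dim D Z) Dbar_Zc emb_inj; congr (\dim _ + _)%N.
apply/vspaceP => x; rewrite !memv_cap -memv_preim memv_ker.
by case: eqP => [->|_]; rewrite ?andbF // mem0v !andbT.
Qed.

Lemma dim_Bc : \dim B = (\dim (P 2 :&: lker D) + \dim decomposable)%N.
Proof.
rewrite -(limg_ker_dim D B) Dbar_Bc emb_inj; congr (\dim _ + _)%N.
apply/eqP; rewrite eqEsubv capvS ?Bc_Pc2 //= subv_cap capvSr andbT.
by rewrite -Dbar_Pc3 addvSl.
Qed.

Lemma tor_dim23 : tor_dim J 2 3 = (\dim (J 3) - \dim decomposable)%N.
Proof. by rewrite /tor_dim /= dim_Zc dim_Bc subnDl. Qed.

Lemma Bc_Zc : (decomposable <= J 3)%VS -> (B <= Z)%VS.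
Proof.
move/subvP=> QJ; apply/subvP => x xB; have xP := subvP Bc_Pc2 x xB.
rewrite memv_cap xP -memv_preim; have := memv_img D xB.
by rewrite Dbar_Bc => /memv_imgP[t /QJ tJ ->]; rewrite emb0_Kc.
Qed.

(** The graded dimensions telescope to that of the last filtration step, a subspace of Tor; this
    bound is enough for a strict comparison. *)
Lemma grtor_le : (decomposable <= J 3)%VS -> (grtor_dim J 2 3 <= tor_dim J 2 3)%N.
Proof.
move=> /Bc_Zc BZ; rewrite /grtor_dim /tor_dim /= telescope_le => [|n].
  by apply/leq_sub2r/dimvS; rewrite subv_add capvSl.
apply/leq_sub2r/dimvS/addvS => //; apply/capvS => //; apply/addvS => //.
apply/subvP => x /(mem_span_delta (fun y : {set 'I_3} * 3.-tuple E => (weight y.2 <= n)%N)) xF.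
apply/(mem_span_delta (fun y : {set 'I_3} * 3.-tuple E => (weight y.2 <= n.+1)%N)) => y yn.
by apply/xF; apply: contra yn; apply: leqW.
Qed.

Local Notation ZE := (ZE J 3 2).
Local Notation BE := (BE J 3 2).

Definition diag (t : Ts 3) : Vs 3 := emb cut1 t + emb cut2 t.

Lemma diag_linear : linear diag.
Proof. by move=> a s t; rewrite /diag !linearP addrACA -scalerDr. Qed.

Lemma dim_diag U : \dim (linfun diag @: U) = \dim U.
Proof.
apply: limg_dim_eq; apply/eqP; rewrite -subv0; apply/subvP => t.
rewrite memv_cap memv_ker memv0 linfunE; last exact: diag_linear.
case/andP=> _ /eqP/(congr1 (part cut1)); rewrite /diag linearD /= !part_emb eqxx.
by have [_ [-> _ _ _]] := cut_eq; rewrite addr0 linear0 => ->.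
Qed.

(** Closedness forces equal components at [cut1] and [cut2]; vanishing on [K] then says that the
    common value kills both summands of [decomposable]. *)
Lemma ZE_diag : ZE = (linfun diag @: annih decomposable)%VS.
Proof.
have [i0 i1 i2 i12] := cut_Pc; have [[e10 e20 _ e01 e02] [e12 e21 e121 e122]] := cut_eq.
apply/vspaceP => x; rewrite !memv_cap memv_ker.
apply/idP/memv_imgP => [/andP[/andP[xP xK] /eqP Dx]|[t tQ ->]].
  have x12 : part cut2 x = part cut1 x.
    by apply/eqP; rewrite -subr_eq0 -Dcobar_cut12 Dx linear0.
  exists (part cut1 x); last first.
    by rewrite linfunE; [rewrite /diag -{2}x12; exact: Pc2E|exact: diag_linear].
  apply/annihP => _ /memv_addP[t1 /memv_imgP[y1 y1K ->] [t2 /memv_imgP[y2 y2K ->] ->]].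
  have x0 S y : y \in K -> @pairing F _ (part S x) (part S y) = 0.
    by move=> yK; rewrite -pairing_emb; apply: (elimT (annihP _ _) xK); apply: Kc_part.
  by rewrite -pairingLE linearD /= !pairingLE -{2}x12 !x0 // addr0.
rewrite linfunE; last exact: diag_linear.
rewrite rpredD //=; apply/andP; split.
  apply/(annihP (Kc J 3)) => y yK.
  rewrite pairing_sym -pairingLE linearD /= !pairingLE !pairing_emb.
  rewrite -!(pairing_sym t) -!pairingLE -linearD /= pairingLE.
  by apply: (elimT (annihP _ _) tQ); apply: memv_add; apply: memv_img.
apply/eqP/ffunP => -[S w]; rewrite [RHS]ffunE -partE.
have [/validS3|vS] := boolP (validS S); last by rewrite partE DcobarE /= (negPf vS).
have c1 : part cut1 (diag t) = t by rewrite /diag linearD /= !part_emb eqxx e12 addr0.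
have c2 : part cut2 (diag t) = t by rewrite /diag linearD /= !part_emb eqxx e21 add0r.
have c0 : part set0 (diag t) = 0 by rewrite /diag linearD /= !part_emb e01 e02 addr0.
rewrite !inE => /or4P[] /eqP->.
- by rewrite Dcobar_set0 ffunE.
- by rewrite Dcobar_cut1 c0 ffunE.
- by rewrite Dcobar_cut2 c0 ffunE.
- by rewrite Dcobar_cut12 c1 c2 subrr ffunE.
Qed.

(** The cochains on the uncut component are the functionals killing [J 3], and the differential
    copies them to both cuts. *)
Lemma BE_diag : BE = (linfun diag @: annih (J 3))%VS.
Proof.
have [i0 i1 i2 i12] := cut_Pc; have [[e10 e20 _ e01 e02] [e12 e21 e121 e122]] := cut_eq.
have Ddiag t : D' (emb set0 t) = diag t.
  apply/ffunP => -[S w]; rewrite -!partE /diag linearD /= !part_emb.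
  have [/validS3|vS] := boolP (validS S); last first.
    have [v0 v1 v2 v12] := valid_cuts; rewrite partE DcobarE /= (negPf vS).
    by case: eqP vS => [->|_]; rewrite ?v1 //; case: eqP => [->|_]; rewrite ?v2 // addr0 ffunE.
  rewrite !inE => /or4P[] /eqP->.
  - by rewrite Dcobar_set0 e01 e02 addr0.
  - by rewrite Dcobar_cut1 part_emb !eqxx e12 addr0.
  - by rewrite Dcobar_cut2 part_emb !eqxx e21 add0r.
  - by rewrite Dcobar_cut12 !part_emb e10 e20 e121 e122 subrr addr0.
apply/vspaceP => x; apply/memv_imgP/memv_imgP => -[t + ->].
  rewrite memv_cap => /andP[/Pc1E -> tK]; exists (part set0 t); last first.
    by rewrite Ddiag (linfunE diag_linear).
  apply/annihP => y; rewrite -part0_Kc => /memv_imgP[z zK ->].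
  have [_ ] := (annihP (Kc J 3) (emb set0 (part set0 t)), zK).
  have := elimT (annihP _ _) tK _ (Kc_part set0 zK).
  by rewrite pairing_emb part_emb eqxx.
move=> tJ; exists (emb set0 t); last by rewrite Ddiag (linfunE diag_linear).
rewrite memv_cap i0; apply/(annihP (Kc J 3)) => y yK.
rewrite pairing_sym pairing_emb pairing_sym; apply: (elimT (annihP _ _) tJ).
by rewrite -part0_Kc; apply: memv_img.
Qed.

Lemma ext_dim23 : ext_dim J 2 3 = (\dim (J 3) - \dim decomposable)%N.
Proof.
rewrite /ext_dim /= ZE_diag BE_diag !dim_diag.
have sub_compl (a b c d n : nat) : (a + b = n -> c + d = n -> a - c = d - b)%N by lia.
exact: (sub_compl _ _ _ _ _ (dim_annih decomposable) (dim_annih (J 3))).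
Qed.

Lemma grext_le : (decomposable <= J 3)%VS -> (grext_dim J 2 3 <= ext_dim J 2 3)%N.
Proof.
move=> /subvP QJ; have BZ : (BE <= ZE)%VS.
  rewrite ZE_diag BE_diag; apply/limgS/subvP => x /annihP xJ.
  by apply/annihP => q /QJ/xJ.
have mono n : (extF_dim J 3 2 n.+1 <= extF_dim J 3 2 n)%N.
  apply/leq_sub2r/dimvS/addvS => //; apply/capvS => //.
  apply/subvP => x /(mem_span_delta (fun y : {set 'I_3} * 3.-tuple E => (n < weight y.2)%N)) xF.
  apply/(mem_span_delta (fun y : {set 'I_3} * 3.-tuple E => (n <= weight y.2)%N)) => y yn.
  by apply/xF; apply: contra yn; apply: ltnW.
rewrite /grext_dim /ext_dim /=.
have := telescope_ge (3 * #|T|).+1 mono; set s := (\sum_(n < _) _)%N => sE.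
(* The telescoped sum plus its last term is the step at 0, so dropping that term gives an upper
   bound. *)
apply: (@leq_trans (extF_dim J 3 2 0)); first by rewrite -sE leq_addr.
by apply/leq_sub2r/dimvS; rewrite subv_add capvSl.
Qed.

End Homology.

(** * Comparison of the ideal with its leading forms *)

Section LowestWeight.
Variables (F : fieldType) (T : finType) (le : rel T) (rk : T -> nat).
Local Notation E := (edge le rk).
Local Notation Ts := (Tsp F le rk).
Local Notation wt := (@weight T le rk).
Local Notation Id := (Ideal F le rk).
Local Notation Id' := (Ideal' F le rk).
Implicit Types (A B C : T -> F).

(** The lowest-weight part of the gradient of [A] when [A] is [supported_above] n. *)
Definition low n A (e : E) : F := if rk (src e) == n then drop_along A e else 0.

Definition supported_above n A := forall e : E, (rk (src e) < n)%N -> drop_along A e = 0.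

Lemma lead1_annihilated n A : supported_above n A ->
  (Id' 1 <= lker (pairingL (fun w : 1.-tuple E => prodf [:: low n A] w)))%VS.
Proof.
move=> An; apply: (@annihilates_lead F T le rk 1 n _ (fun w => prodf [:: drop_along A] w));
  last exact: Ideal1_annihilated; move=> [[|e [|? ?]] //= sz];
  rewrite !prodf_cons !prodf_nil !mulr1 weight_cons weight_nil addn0 //.
exact: An.
Qed.

(** The tensor of the two low parts is the component in weight n + m of the tensor of gradients,
    which has nothing of smaller weight; [annihilates_lead] applies. *)
Lemma lead2_annihilated n m A B C : supported_above n A -> supported_above m B ->
  (forall e : E, drop_along A e * B (tgt e) = drop_along C e) ->
  (Id' 2 <= lker (pairingL (fun w : 2.-tuple E => prodf [:: low n A; low m B] w)))%VS.
Proof.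
move=> An Bm ABC.
apply: (@annihilates_lead F T le rk 2 (n + m) _
    (fun w => prodf [:: drop_along A; drop_along B] w));
  last exact: (Ideal2_annihilated ABC); move=> [[|e [|e' [|? ?]]] //= sz];
  rewrite !prodf_cons !prodf_nil !mulr1 !weight_cons weight_nil addn0 /low.
- case: (ltngtP (rk (src e)) n) => [en|en|->].
  + by rewrite An // !mul0r if_same.
  (* If the first rank exceeds n while the total is n + m, the second is below m and [B] contributes
     zero. *)
  + rewrite mul0r; case: eqP => // enm; rewrite (Bm e') ?mulr0 //; lia.
  + by rewrite eqn_add2l; case: eqP; rewrite ?mulr0.
- move=> enm; have [en|ne] := ltnP (rk (src e)) n; first by rewrite An ?mul0r.
  by rewrite (Bm e') ?mulr0 //; lia.
Qed.

Lemma tmul_annihilated j k u v (fs gs hs : seq (E -> F)) (g : Ts k) :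
  size fs = size u -> size gs = k -> j = (size u + k + size v)%N ->
  g \in lker (pairingL (fun w : k.-tuple E => prodf gs w)) ->
  tmul j u g v \in lker (pairingL (fun w : j.-tuple E => prodf (fs ++ gs ++ hs) w)).
Proof.
rewrite !memv_ker !pairingLE => fu gk jE /eqP g0.
rewrite (pairing_tmul (prodf (fs ++ gs ++ hs)) _ jE).
rewrite -[X in _ == X](mulr0 (prodf fs u * prodf hs v)) -[X in _ * X]g0.
rewrite /pairing mulr_sumr; apply/eqP/eq_bigr => t _.
by rewrite prodf_cat // prodf_cat ?size_tuple //; ring.
Qed.

End LowestWeight.

Section Comparison.
Variables (F : fieldType) (T : finType) (le : rel T) (rk : T -> nat).
Local Notation E := (edge le rk).
Local Notation Ts := (Tsp F le rk).
Local Notation Id := (Ideal F le rk).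
Local Notation Id' := (Ideal' F le rk).
Hypothesis rk_le : forall x, (rk x <= #|T|)%N.

Lemma decomposable_Ideal : (decomposable Id <= Id 3)%VS.
Proof.
apply: decomposable_ind => k u v g uv gI; apply: tmul_Ideal gI.
by move: uv; rewrite !inE !xpair_eqE; lia.
Qed.

(** A leading form of a relation, multiplied by words, is the leading form of the multiplied
    relation. *)
Lemma decomposable_lead : (decomposable Id' <= lead (decomposable Id))%VS.
Proof.
apply: decomposable_ind => k u v g uv; apply: tmul_lead => // {}g.
exact: mem_decomposable.
Qed.

Lemma gr_dims_lt x : x \in lead (decomposable Id) -> x \notin decomposable Id' ->
  (grext_dim Id 2 3 < ext_dim Id' 2 3)%N /\ (grtor_dim Id 2 3 < tor_dim Id' 2 3)%N.
Proof.
move=> xQ xQ'.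
have dQ : (\dim (decomposable Id') < \dim (decomposable Id))%N.
  rewrite -(dim_lead rk_le (decomposable Id)) ltn_neqAle dimvS ?decomposable_lead // andbT.
  apply: contra xQ' => /eqP dE; suff -> : decomposable Id' = lead (decomposable Id) by [].
  by apply/eqP; rewrite eqEdim decomposable_lead dE leqnn.
have dI := dimvS decomposable_Ideal; have dI' := dim_lead rk_le (Id 3).
(* Strictness survives truncated subtraction because [decomposable Id] lies inside [Id 3], whose
   dimension equals that of [Id' 3]. *)
have lt : (\dim (Id 3) - \dim (decomposable Id) < \dim (Id' 3) - \dim (decomposable Id'))%N.
  by rewrite /Ideal' in dQ *; rewrite dI'; lia.
split.
  by rewrite ext_dim23; apply: leq_ltn_trans (grext_le decomposable_Ideal) _; rewrite ext_dim23.
by rewrite tor_dim23; apply: leq_ltn_trans (grtor_le decomposable_Ideal) _; rewrite tor_dim23.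
Qed.

End Comparison.

(** * The syzygy below u and the cubic relation it produces *)

Section Syzygy.
Variables (F : fieldType) (T : finType) (le : rel T) (rk : T -> nat).
Local Notation E := (edge le rk).
Local Notation Ts := (Tsp F le rk).
Local Notation Id := (Ideal F le rk).
Variables p1 p2 a1 a2 b1 b2 c1 c2 d1 d2 : E.

Definition monom3 (a b c : E) : Ts 3 := delta F [tuple a; b; c].

(* [(v1 - v2) (c1 d1 - c2 d2)], with [a1 - b1] standing for [v1 - v2], where the edges are
   [p_i = u -> v_i], [a_i = v1 -> y_i], [b_i = v2 -> y_i], [c_i = y_i -> z_i] and
   [d_i = z_i -> *]. *)
Definition obstruction : Ts 3 :=
  monom3 a1 c1 d1 - monom3 a1 c2 d2 - (monom3 b1 c1 d1 - monom3 b1 c2 d2).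

(** Only the monomial a1 c1 d1 survives: the other terms contain [b1] in first place or [d2] in last
    place. *)
Lemma pairing_obstruction (f1 f2 f3 : E -> F) :
  f1 a1 = 1 -> f1 b1 = 0 -> f2 c1 = 1 -> f3 d1 = 1 -> f3 d2 = 0 ->
  pairing (fun w : 3.-tuple E => prodf [:: f1; f2; f3] w) obstruction = 1.
Proof.
move=> f1a f1b f2c f3d1 f3d2; set phi := fun w => _.
have pd a b c : pairing phi (monom3 a b c) = f1 a * (f2 b * f3 c).
  by rewrite [LHS]pairing_delta /phi !prodf_cons prodf_nil mulr1.
have pB (x y : Ts 3) : pairing phi (x - y) = pairing phi x - pairing phi y.
  by rewrite -!pairingLE linearB.
pose sub (s t : F) := s - t.
apply: etrans (etrans (pB _ _) (congr2 sub (pB _ _) (pB _ _))) _.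
apply: etrans (congr2 sub (congr2 sub (pd _ _ _) (pd _ _ _))
                          (congr2 sub (pd _ _ _) (pd _ _ _))) _.
by rewrite /sub f1a f1b f2c f3d1 f3d2 !(mul0r, mul1r, subr0, mulr0).
Qed.

(** Being homogeneous of weight 6, the element is its own leading form. *)
Lemma obstruction_lead : (forall x, (rk x <= #|T|)%N) -> obstruction \in decomposable Id ->
  weight [:: a1; c1; d1] = 6%N -> weight [:: a1; c2; d2] = 6%N ->
  weight [:: b1; c1; d1] = 6%N -> weight [:: b1; c2; d2] = 6%N ->
  obstruction \in lead (decomposable Id).
Proof.
move=> rk_le oQ w1 w2 w3 w4.
have o0 (w : 3.-tuple E) : weight w != 6%N -> obstruction w = 0.
  move=> w6; rewrite !ffunE.
  have ne (t : 3.-tuple E) : weight t = 6%N -> (w == t) = false.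
    by move=> t6; apply: contraNF w6 => /eqP->; rewrite t6.
  by rewrite !ne // !subr0.
have <- : projw F le rk 3 6 obstruction = obstruction.
  by apply/ffunP => w; rewrite projwE; case: ifP => // /negbT/o0.
apply: mem_lead => //; apply/FwP => w w6; apply: o0.
by rewrite gtn_eqF.
Qed.

Lemma esym_consS (e e' : E) p k w : Defs.esym F (e :: p) k.+1 (e' :: w) =
  Defs.esym F p k.+1 (e' :: w) - (e' == e)%:R * Defs.esym F p k w.
Proof. by rewrite esym_cons. Qed.

Lemma tvecl e (r : seq E -> F) (w : 3.-tuple E) x y z : tval w = [:: x; y; z] ->
  tvec 3 [:: e] r [::] w = (x == e)%:R * r [:: y; z].
Proof.
move=> wE; rewrite ffunE wE /ins_val /= eqseq_cons !andbT.
by case: eqP; rewrite ?mul1r ?mul0r.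
Qed.

Lemma tvecr e (r : seq E -> F) (w : 3.-tuple E) x y z : tval w = [:: x; y; z] ->
  tvec 3 [::] r [:: e] w = r [:: x; y] * (z == e)%:R.
Proof.
move=> wE; rewrite ffunE wE /ins_val /= eqseq_cons !andbT.
by case: eqP; rewrite ?mulr1 ?mulr0.
Qed.

Lemma tvecrr e e' (r : seq E -> F) (w : 3.-tuple E) x y z : tval w = [:: x; y; z] ->
  tvec 3 [::] r [:: e; e'] w = r [:: x] * ((y == e)%:R * (z == e')%:R).
Proof.
move=> wE; rewrite ffunE wE /ins_val /= !eqseq_cons !andbT.
by do 2!case: eqP; rewrite ?mulr1 ?mulr0 ?mul0r.
Qed.

Lemma monom3E a b c (w : 3.-tuple E) x y z : tval w = [:: x; y; z] ->
  monom3 a b c w = (x == a)%:R * (y == b)%:R * (z == c)%:R.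
Proof.
move=> wE; rewrite ffunE -val_eqE /= wE !eqseq_cons andbT.
by do 3!case: eqP; rewrite ?mulr1 ?mulr0 ?mul0r.
Qed.

Lemma esym21 (a b x : E) :
  Defs.esym F [:: a; b] 1 [:: x] = - (x == a)%:R - (x == b)%:R.
Proof. by rewrite !(esym_consS, esym_nil, esym0) /=; ring. Qed.

Lemma esym22 (a b x y : E) :
  Defs.esym F [:: a; b] 2 [:: x; y] = (x == a)%:R * (y == b)%:R.
Proof. by rewrite !(esym_consS, esym_nil, esym0) /=; ring. Qed.

Lemma esym32 (a b c x y : E) : Defs.esym F [:: a; b; c] 2 [:: x; y] =
  (x == a)%:R * (y == b)%:R + (x == a)%:R * (y == c)%:R + (x == b)%:R * (y == c)%:R.
Proof. by rewrite !(esym_consS, esym_nil, esym0) /=; ring. Qed.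

Variables u v1 v2 y1 y2 bot : T.
Hypothesis T_gt3 : (3 < #|T|)%N.
Hypotheses (pa1 : is_pathb u y1 [:: p1; a1]) (pb1 : is_pathb u y1 [:: p2; b1]).
Hypotheses (pa2 : is_pathb u y2 [:: p1; a2]) (pb2 : is_pathb u y2 [:: p2; b2]).
Hypotheses (pv11 : is_pathb v1 bot [:: a1; c1; d1]) (pv12 : is_pathb v1 bot [:: a2; c2; d2]).
Hypotheses (pv21 : is_pathb v2 bot [:: b1; c1; d1]) (pv22 : is_pathb v2 bot [:: b2; c2; d2]).

Let mem_dec k m b a p p' s t : is_pathb b a p -> is_pathb b a p' ->
  (size p <= 3)%N -> (size p' <= 3)%N -> (m <= size p)%N ->
  (size s, k, size t) \in [:: (0, 1, 2); (1, 2, 0); (0, 2, 1); (2, 1, 0)]%N ->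
  tvec 3 s (esymB F p p' m) t \in decomposable Id.
Proof.
move=> pP pP' sp sp' mp st.
rewrite -[s]cats0 -(cat0s t) -(@tmul_tvec _ _ _ _ 3 k); last first.
  by move: st; rewrite !inE => /or4P[] /eqP[-> -> ->].
apply: mem_decomposable => //.
(* The relations range over paths with fewer than [#|T|] edges, so those of length at most 3 are
   included. *)
have lt3 n : (n <= 3 -> n < #|T|)%N by move=> n3; apply: leq_ltn_trans n3 T_gt3.
exact: (@Ideal_gen F T le rk k [::] [::] b a p p' m pP pP' (lt3 _ sp) (lt3 _ sp') isT isT mp).
Qed.

Local Notation "x ? e" := ((x == e)%:R : F) (at level 30, no associativity).

(** This and the next two give the multiples used in the syzygy: an edge times the degree-2 relation
    of two 3-step paths, the degree-2 relation of two 2-step paths times an edge, and their degree-1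
    relation times two edges. *)
Let cubicl e b a p q r p' q' r' : is_pathb b a [:: p; q; r] -> is_pathb b a [:: p'; q'; r'] ->
  exists2 t, t \in decomposable Id & forall (w : 3.-tuple E) x y z, tval w = [:: x; y; z] ->
  t w = x ? e * (y ? p * z ? q + y ? p * z ? r + y ? q * z ? r -
                 (y ? p' * z ? q' + y ? p' * z ? r' + y ? q' * z ? r')).
Proof.
move=> pP pP'; exists (tvec 3 [:: e] (esymB F [:: p; q; r] [:: p'; q'; r'] 2) [::]).
  exact: (@mem_dec 2 2 b a).
move=> w x y z wE; apply: etrans (tvecl _ _ wE) _; congr (_ * _).
by rewrite /esymB (esym32 p) (esym32 p').
Qed.

Let quadr e b a p q p' q' : is_pathb b a [:: p; q] -> is_pathb b a [:: p'; q'] ->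
  exists2 t, t \in decomposable Id & forall (w : 3.-tuple E) x y z, tval w = [:: x; y; z] ->
  t w = (x ? p * y ? q - x ? p' * y ? q') * z ? e.
Proof.
move=> pP pP'; exists (tvec 3 [::] (esymB F [:: p; q] [:: p'; q'] 2) [:: e]).
  exact: (@mem_dec 2 2 b a).
move=> w x y z wE; apply: etrans (tvecr _ _ wE) _; congr (_ * _).
by rewrite /esymB (esym22 p) (esym22 p').
Qed.

Let linrr e e' b a p q p' q' : is_pathb b a [:: p; q] -> is_pathb b a [:: p'; q'] ->
  exists2 t, t \in decomposable Id & forall (w : 3.-tuple E) x y z, tval w = [:: x; y; z] ->
  t w = (x ? p' + x ? q' - x ? p - x ? q) * (y ? e * z ? e').
Proof.
move=> pP pP'; exists (tvec 3 [::] (esymB F [:: p; q] [:: p'; q'] 1) [:: e; e']).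
  exact: (@mem_dec 1 1 b a).
move=> w x y z wE; apply: etrans (tvecrr _ _ _ wE) _; congr (_ * _).
by rewrite /esymB (esym21 p) (esym21 p'); ring.
Qed.

(** Let R_i be the degree-2 relation of the two paths from v_i to [bot], and consider (p1 + a1 - b1)
    R_2 - p1 R_1. In its terms with middle edge b_i, the linear relation replaces p1 + a1 - b1 by
    p2, and p2 b_i = p1 a_i cancels them against those of R_1. The terms in c_i d_i leave (a1 -
    b1)(c1 d1 - c2 d2). *)
Lemma obstruction_mem : obstruction \in decomposable Id.
Proof.
have [t1 m1 E1] := cubicl p1 pv21 pv22; have [t2 m2 E2] := cubicl p1 pv11 pv12.
have [t3 m3 E3] := cubicl a1 pv21 pv22; have [t4 m4 E4] := cubicl b1 pv21 pv22.
have [t5 m5 E5] := quadr c1 pa1 pb1; have [t6 m6 E6] := quadr d1 pa1 pb1.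
have [t7 m7 E7] := quadr c2 pa2 pb2; have [t8 m8 E8] := quadr d2 pa2 pb2.
have [t9 m9 E9] := linrr b1 c1 pa1 pb1; have [t10 m10 E10] := linrr b1 d1 pa1 pb1.
have [t11 m11 E11] := linrr b2 c2 pa1 pb1; have [t12 m12 E12] := linrr b2 d2 pa1 pb1.
have -> : obstruction = t1 - t2 + t3 - t4 + t5 + t6 - t7 - t8 + t9 + t10 - t11 - t12;
  last by rewrite !(rpredD, rpredN).
apply/ffunP => w.
have [x [y [z wE]]] : exists x y z, tval w = [:: x; y; z].
  by case: w => [[|x [|y [|z [|? ?]]]] //= _]; exists x, y, z.
have M a b c := monom3E a b c wE.
have addE (f g : Ts 3) : (f + g) w = f w + g w by rewrite ffunE.
have subE (f g : Ts 3) : (f - g) w = f w - g w by rewrite !ffunE.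
pose sub (s t : F) := s - t.
apply: etrans (etrans (subE _ _) (congr2 sub (subE _ _) (subE _ _))) _.
apply: etrans (congr2 sub (congr2 sub (M _ _ _) (M _ _ _)) (congr2 sub (M _ _ _) (M _ _ _))) _.
rewrite /sub !(subE, addE) (E1 _ _ _ _ wE) (E2 _ _ _ _ wE) (E3 _ _ _ _ wE) (E4 _ _ _ _ wE).
rewrite (E5 _ _ _ _ wE) (E6 _ _ _ _ wE) (E7 _ _ _ _ wE) (E8 _ _ _ _ wE).
rewrite (E9 _ _ _ _ wE) (E10 _ _ _ _ wE) (E11 _ _ _ _ wE) (E12 _ _ _ _ wE).
ring.
Qed.

End Syzygy.

(** * The poset *)

(* Hasse diagram, with [*, z1, z2, y1, y2, v1, v2, u] encoded as [0, ..., 7]: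
   [zi -> *], [yi -> zi], [vi -> y1, y2], [u -> v1, v2]; among elements of different ranks, only the pairs
   [(z1, y2)] and [(z2, y1)] are incomparable. *)
Definition rkN (x : nat) : nat := x.+1./2.
Definition leN (x y : nat) : bool :=
  (x == y) || [&& (rkN x < rkN y)%N & ~~ ((0 < x)%N && (x + y == 5)%N)].

Definition rk8 (x : 'I_8) : nat := rkN x.
Definition le8 : rel 'I_8 := fun x y => leN x y.

Lemma all8 (p : pred nat) : all p (iota 0 8) -> forall x : 'I_8, p x.
Proof. by move=> /allP pP x; apply: pP; rewrite mem_iota ltn_ord. Qed.

Lemma ltp8E (x y : 'I_8) : ltp le8 x y = (val x != val y) && leN x y.
Proof. by []. Qed.

Lemma is_poset8 : is_poset le8.
Proof.
split=> [x|x y|y x z]; first by rewrite /le8 /leN eqxx.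
  have := @all8 (fun x => all (fun y => leN x y && leN y x ==> (x == y)) (iota 0 8)) isT x.
  by move/all8/(_ y)/implyP => xy /xy/eqP; apply: val_inj.
have := @all8 (fun x => all (fun y => all (fun z => leN x y ==> leN y z ==> leN x z)
  (iota 0 8)) (iota 0 8)) isT x.
by move/all8/(_ y)/all8/(_ z)/implyP => H /H/implyP.
Qed.

(** Checked by enumeration: a comparable pair whose rank gap is not 1 has an element strictly
    between. *)
Lemma rank_of_cover (x y : 'I_8) : ltp le8 x y ->
  (forall z, ~~ (ltp le8 x z && ltp le8 z y)) -> rk8 y = (rk8 x).+1.
Proof.
move=> xy noz; apply/eqP; apply: contraT => ne.
have /all8/(_ y) := @all8 (fun x => all (fun y =>
  [&& x != y, leN x y & rkN y != (rkN x).+1] ==>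
  has (fun z => [&& x != z, leN x z, z != y & leN z y]) (iota 0 8)) (iota 0 8)) isT x.
move: xy; rewrite ltp8E => /andP[-> ->]; rewrite ne => /hasP[z].
rewrite mem_iota => /andP[_ z8] /and4P[xz lxz zy lzy].
by have /negP[] := noz (Ordinal z8); rewrite !ltp8E xz lxz zy lzy.
Qed.

Lemma ranked_poset8 : ranked_poset le8 ord0 rk8.
Proof.
have le0 (m : 'I_8) : le8 ord0 m by apply: (@all8 (fun m => leN 0 m)).
split=> [|y|m mP|x s [sP <- sat]]; first exact: is_poset8.
- move=> y0; apply/val_inj/eqP; move: (y0).
  by have /implyP := @all8 (fun y => leN y 0 ==> (y == 0%N)) isT y.
- by rewrite (mP _ (le0 m)).
(* The starting point [a] changes in the induction while the default [d] of [nth] stays fixed, so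
   the two are generalised separately. *)
suff main d a : path (ltp le8) a s -> (forall k, (k < size s)%N -> forall z,
    ~~ (ltp le8 (nth d (a :: s) k) z && ltp le8 z (nth d s k))) ->
    (size s + rk8 a)%N = rk8 (last a s).
  by rewrite -(main _ _ sP sat) addn0.
elim: s a {sP sat} => [|c s IH] a //= /andP[ac sP] sat.
apply: etrans (IH c sP (fun k => sat k.+1)).
by rewrite (rank_of_cover ac (sat 0%N isT)) addnS addSn.
Qed.

Lemma rk8_le (x : 'I_8) : (rk8 x <= #|'I_8|)%N.
Proof. by rewrite card_ord; apply: (@all8 (fun x => rkN x <= 8)%N). Qed.

Local Notation E := (edge le8 rk8).

Definition mk_edge (x y : nat) (x8 : (x < 8)%N) (y8 : (y < 8)%N)
  (xy : covers le8 rk8 (Ordinal x8, Ordinal y8)) : E := exist _ (Ordinal x8, Ordinal y8) xy.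

Definition p1 := @mk_edge 7 5 isT isT isT.
Definition p2 := @mk_edge 7 6 isT isT isT.
Definition a1 := @mk_edge 5 3 isT isT isT.
Definition a2 := @mk_edge 5 4 isT isT isT.
Definition b1 := @mk_edge 6 3 isT isT isT.
Definition b2 := @mk_edge 6 4 isT isT isT.
Definition c1 := @mk_edge 3 1 isT isT isT.
Definition c2 := @mk_edge 4 2 isT isT isT.
Definition d1 := @mk_edge 1 0 isT isT isT.
Definition d2 := @mk_edge 2 0 isT isT isT.

Lemma edge8P (e : E) : (val (src e), val (tgt e)) \in
  [:: (1, 0); (2, 0); (3, 1); (4, 2); (5, 3); (5, 4); (6, 3); (6, 4); (7, 5); (7, 6)]%N.
Proof.
have /all8/(_ (tgt e))/implyP := @all8 (fun x => all (fun y =>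
  [&& y != x, leN y x & rkN x == (rkN y).+1] ==> ((x, y) \in
  [:: (1, 0); (2, 0); (3, 1); (4, 2); (5, 3); (5, 4); (6, 3); (6, 4); (7, 5); (7, 6)]%N))
  (iota 0 8)) isT (src e).
by apply; have := valP e; rewrite /covers ltp8E -andbA.
Qed.

(** * The cubic form separating the two spaces of decomposable relations *)

Section Field.
Variable F : fieldType.
Local Notation Ts := (Tsp F le8 rk8).
Local Notation Id := (Ideal F le8 rk8).
Local Notation Id' := (Ideal' F le8 rk8).

Definition indic (s : seq nat) (x : 'I_8) : F := (val x \in s)%:R.

Lemma edge8_ind (Q : nat -> nat -> Prop) :
  [/\ Q 1 0, Q 2 0, Q 3 1, Q 4 2 & Q 5 3]%N -> [/\ Q 5 4, Q 6 3, Q 6 4, Q 7 5 & Q 7 6]%N ->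
  forall e : E, Q (val (src e)) (val (tgt e)).
Proof.
move=> [? ? ? ? ?] [? ? ? ? ?] e; have := edge8P e; rewrite !inE !xpair_eqE.
by do !case/orP; case/andP=> /eqP-> /eqP->.
Qed.

(** Here 5 is v1 and 3, 4 are y1, y2. Including 5 in the second potential gives u -> v1 the nonzero
    value that makes the product a gradient. *)
Lemma potential_v e : drop_along (indic [:: 5]%N) e * indic [:: 5; 3; 4]%N (tgt e) =
  drop_along (indic [:: 5]%N) (e : E).
Proof.
rewrite /drop_along /indic; apply: (@edge8_ind (fun x y => ((x \in [:: 5]%N)%:R -
  (y \in [:: 5]%N)%:R) * (y \in [:: 5; 3; 4]%N)%:R =
  (x \in [:: 5]%N)%:R - (y \in [:: 5]%N)%:R :> F)) e;
by split; rewrite !inE /=; ring.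
Qed.

(** Here 1 is z1. The extra vertex 3, that is y1, supplies the value on v_i -> y1 required for a
    gradient. *)
Lemma potential_y e : drop_along (indic [:: 3; 4]%N) e * indic [:: 1; 3]%N (tgt e) =
  drop_along (indic [:: 3]%N) (e : E).
Proof.
rewrite /drop_along /indic; apply: (@edge8_ind (fun x y => ((x \in [:: 3; 4]%N)%:R -
  (y \in [:: 3; 4]%N)%:R) * (y \in [:: 1; 3]%N)%:R =
  (x \in [:: 3]%N)%:R - (y \in [:: 3]%N)%:R :> F)) e;
by split; rewrite !inE /=; ring.
Qed.

Lemma supported_indic n s : all (fun xy : nat * nat =>
    (rkN xy.1 < n)%N ==> (xy.1 \notin s) && (xy.2 \notin s))
  [:: (1, 0); (2, 0); (3, 1); (4, 2); (5, 3); (5, 4); (6, 3); (6, 4); (7, 5); (7, 6)]%N ->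
  supported_above le8 rk8 n (indic s).
Proof.
move=> /allP H e en; have /implyP/(_ en)/andP[/negPf sF /negPf tF] := H _ (edge8P e).
by rewrite /drop_along /indic sF tF subrr.
Qed.

(** [f1], [f2], [f3] detect the edges leaving v1, leaving y1 or y2, and leaving z1. *)
Definition f1 : E -> F := low 3 (indic [:: 5]%N).
Definition f2 : E -> F := low 2 (indic [:: 3; 4]%N).
Definition f3 : E -> F := low 1 (indic [:: 1; 3]%N).

(** The correction at v1 affects only edges of rank at least 3, so the rank-2 part is unchanged. *)
Lemma f2E (e : E) : low 2 (indic [:: 5; 3; 4]%N) e = f2 e.
Proof.
rewrite /f2 /low; case: eqP => //; rewrite /drop_along /indic /rk8.
apply: (@edge8_ind (fun x y => rkN x = 2%N -> (x \in [:: 5; 3; 4]%N)%:R -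
  (y \in [:: 5; 3; 4]%N)%:R = (x \in [:: 3; 4]%N)%:R - (y \in [:: 3; 4]%N)%:R :> F)) e.
by split; rewrite !inE. by split; rewrite !inE.
Qed.

Definition dual_form (w : seq E) : F := prodf [:: f1; f2; f3] w.

(** Each of the four kinds of product is killed by the one or two adjacent tensor factors facing the
    relation. *)
Lemma decomposable_annihilated :
  (decomposable Id' <= lker (pairingL (fun w : 3.-tuple E => dual_form w)))%VS.
Proof.
have S1 : supported_above le8 rk8 3 (indic [:: 5]%N) by apply: supported_indic.
have S2 : supported_above le8 rk8 2 (indic [:: 5; 3; 4]%N) by apply: supported_indic.
have S2' : supported_above le8 rk8 2 (indic [:: 3; 4]%N) by apply: supported_indic.
have S3 : supported_above le8 rk8 1 (indic [:: 1; 3]%N) by apply: supported_indic.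
apply: decomposable_ind => k u v g; rewrite !inE => /or4P[] /eqP[su kE sv]; subst k => gI.
- apply: (@tmul_annihilated _ _ _ _ 3 1 u v [::] [:: f1] [:: f2; f3]) => //; rewrite ?su ?sv //.
  exact: subvP (lead1_annihilated S1) _ gI.
- apply: (@tmul_annihilated _ _ _ _ 3 2 u v [:: f1] [:: f2; f3] [::]) => //; rewrite ?su ?sv //.
  exact: subvP (lead2_annihilated S2' S3 potential_y) _ gI.
- apply: (@tmul_annihilated _ _ _ _ 3 2 u v [::] [:: f1; f2] [:: f3]) => //; rewrite ?su ?sv //.
  (* The quadratic functional on the left pair needs the corrected potential; [f2E] identifies its
     low part with [f2]. *)
  have := subvP (lead2_annihilated S1 S2 potential_v) _ gI.
  rewrite !memv_ker !pairingLE; congr (_ == _); apply: eq_bigr => w _.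
  by case: w => [[|e [|e' [|? ?]]] //= ?]; rewrite !prodf_cons f2E.
- apply: (@tmul_annihilated _ _ _ _ 3 1 u v [:: f1; f2] [:: f3] [::]) => //; rewrite ?su ?sv //.
  exact: subvP (lead1_annihilated S3) _ gI.
Qed.

Let z8 (n : nat) (n8 : (n < 8)%N) : 'I_8 := Ordinal n8.

Lemma obstruction8_mem :
  obstruction F a1 b1 c1 c2 d1 d2 \in decomposable (Ideal F le8 rk8).
Proof.
apply: (@obstruction_mem F _ le8 rk8 p1 p2 a1 a2 b1 b2 c1 c2 d1 d2
  (@z8 7 isT) (@z8 5 isT) (@z8 6 isT) (@z8 3 isT) (@z8 4 isT) (@z8 0 isT)) => //.
by rewrite card_ord.
Qed.

Lemma obstruction8_lead :
  obstruction F a1 b1 c1 c2 d1 d2 \in lead (decomposable (Ideal F le8 rk8)).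
Proof.
apply: obstruction_lead; rewrite ?weight_cons ?weight_nil //.
  exact: rk8_le.
exact: obstruction8_mem.
Qed.

(** The cubic form takes the value 1 here and vanishes on the decomposable relations of the graded
    algebra. *)
Lemma obstruction8_notin :
  obstruction F a1 b1 c1 c2 d1 d2 \notin decomposable (Ideal' F le8 rk8).
Proof.
apply/negP => /(subvP decomposable_annihilated); rewrite memv_ker pairingLE.
have f1a : f1 a1 = 1 by rewrite /f1 /low /drop_along /indic /= ?subr0.
have f1b : f1 b1 = 0 by rewrite /f1 /low /drop_along /indic /= ?subr0.
have f2c : f2 c1 = 1 by rewrite /f2 /low /drop_along /indic /= ?subr0.
have f3d1 : f3 d1 = 1 by rewrite /f3 /low /drop_along /indic /= ?subr0.
have f3d2 : f3 d2 = 0 by rewrite /f3 /low /drop_along /indic /= ?subr0.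
have E := pairing_obstruction c2 f1a f1b f2c f3d1 f3d2.
by move/eqP/(etrans (esym E))/eqP; rewrite oner_eq0.
Qed.

End Field.

Theorem theorem1p3 (F : fieldType) :
  exists (T : finType) (le : rel T) (star : T) (rk : T -> nat),
    ranked_poset le star rk /\
    (exists i j : nat,
       grext_dim (@Ideal F T le rk) i j <> ext_dim (@Ideal' F T le rk) i j) /\
    (exists i j : nat,
       grtor_dim (@Ideal F T le rk) i j <> tor_dim (@Ideal' F T le rk) i j).
Proof.
exists 'I_8, le8, ord0, rk8; split; first exact: ranked_poset8.
have [lt_ext lt_tor] := gr_dims_lt rk8_le (obstruction8_lead F) (obstruction8_notin F).
by split; exists 2%N, 3%N => eq; [move: lt_ext | move: lt_tor]; rewrite eq ltnn.
Qed.
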